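(* Let $M$ be a manifold, $\mathcal{M}=M\times\mathbb{R}_+$ the trivial principal $\mathbb{R}_+$-bundle with fiber coordinate $s$, $\eta$ a contact form on $M$ with $C=\ker\eta$, $\mu$ a 1-form on $M$, $g_M$ a Riemannian metric on $M$, and $$\omega=\mathrm{d}s\wedge\eta+s\,\mathrm{d}\eta,\qquad g=s\Big(\big(\tfrac{\mathrm{d}s}{s}+\mu\big)^2+g_M\Big).$$ Let $J:T\mathcal{M}\to T\mathcal{M}$ be the $(1,1)$-tensor defined by $g(X,Y)=\omega(X,J(Y))$, let $\nabla=s\partial_s$, let $X^h=X-\mu(X)\nabla$ be the horizontal lift of a vector field $X$ on $M$, and let $C^h$ be the distribution spanned by the lifts $X^h$, $X\in C$. Then $J^2=-\mathrm{id}$ if and only if $J^2(\nabla)=-\nabla$ and there is a complex structure $\phi_C:C\to C$, $\phi_C^2=-\mathrm{id}_C$, on the vector bundle $C$ such that $$J(X^h)=\big(\phi_C(X)\big)^h\quad\text{for all }X\in C.$$ In this case, $\phi_C$ is a Levi structure on the contact manifold $(M,\eta)$ with the Levi form equal to $g_C=g_M|_C$, $$g_C(X,Y)=\mathrm{d}\eta\big(X,\phi_C(Y)\big),\qquad X,Y\in C,$$ and $J(\nabla)=A^h$, where the vector field $A$ on $M$ is uniquely determined by the conditions $$\mathrm{d}\eta(A,X)=\mu(X)\ \text{ for all }X\in C,\qquad \eta(A)=1,$$ equivalently, by $g_M(A,\cdot)=\eta$, $\eta(A)=1$. In particular, the splitting $T\mathcal{M}=W\oplus C^h$, with $W=\mathrm{span}\langle\nabla,A^h\rangle$,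 is $J$-invariant and $g$-orthogonal, and $$\mathrm{d}\eta\big(\phi_C(X),\phi_C(Y)\big)=\mathrm{d}\eta(X,Y),\qquad X,Y\in C.$$
   Context: $\mathbb{R}_+$ is the multiplicative group of positive reals acting on $\mathcal{M}$ by multiplication of $s$. Vector fields and forms on $M$ are identified with their ($s$-independent) lifts, respectively pullbacks, to $\mathcal{M}$. ''$X\in C$'' means that $X$ is a vector field with values in $C$. Conventions: $\mathrm{d}\eta(X,Y)=X\eta(Y)-Y\eta(X)-\eta([X,Y])$, $(\alpha\wedge\beta)(X,Y)=\alpha(X)\beta(Y)-\alpha(Y)\beta(X)$, $\alpha^2=\alpha\otimes\alpha$. A contact form on a manifold of dimension $2n+1$ is a 1-form $\eta$ with $\eta\wedge(\mathrm{d}\eta)^n\ne0$ everywhere. A Levi structure on $(M,\eta)$ is a vector bundle endomorphism $\phi_C:C\to C$, $\phi_C^2=-\mathrm{id}_C$, such that the Levi form $(X,Y)\mapsto\mathrm{d}\eta(X,\phi_C(Y))$ on $C$ is symmetric and positive definite. (The pairs $(\omega,g)$ above are, up to choice of trivialization, exactly the pairs of a 1-homogeneous symplectic form and a 1-homogeneous Riemannian metric on a principal $\mathbb{R}_+$-bundle.)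
   Formalization: The condition dη(A,X)=μ(X) is corrected to dη(X,A)=μ(X) for X∈C, since the printed sign fails under the stated conventions (e.g. M=R^3, η=dz−y dx, μ=−dy, g_M=η²+(dx−η)²+dy²). *)

(* Defs.v *)
From HB Require Import structures.
From mathcomp Require Import all_boot all_order all_algebra perm.
From mathcomp Require Import all_classical all_reals all_analysis.

Set Implicit Arguments.
Unset Strict Implicit.
Unset Printing Implicit Defensive.
Import Order.TTheory GRing.Theory Num.Theory.
Import numFieldNormedType.Exports.
Local Open Scope classical_set_scope.
Local Open Scope ring_scope.

Section SmoothMaps.
Context {R : realType}.

(* C^k maps on an open set U of a finite-dimensional space V. *)
Fixpoint Ck (V W : normedModType R) (k : nat) (U : set V) (f : V -> W) : Prop :=
  match k with
  | 0 => forall x, U x -> {for x, continuous f}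
  | k'.+1 => (forall x, U x -> differentiable f x) /\
             (forall v, Ck k' U (fun x => 'D_v f x))
  end.

Definition smooth_on (V W : normedModType R) (U : set V) (f : V -> W) :=
  forall k, Ck k U f.

Lemma differentiable_near_eq (V W : normedModType R) (f g : V -> W) (x : V) :
  {near x, f =1 g} -> differentiable f x -> differentiable g x.
Proof.
move=> fg df.
have dfc : continuous ('d f x) by exact: diff_continuous.
have H : g \o shift x = cst (g x) + 'd f x +o_ 0 id.
  apply/eqaddoP => _/posnumP[e].
  have /eqaddoP /(_ e%:num (gt0 e)) := diff_locally df.
  have fg0 : \forall h \near 0, f (h + x) = g (h + x).
    by move: fg; rewrite (near_shift 0) /= subr0.
  apply: filterS2 fg0 => h fgh.
  by rewrite !fctE /= -fgh (nbhs_singleton fg).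
have dg : 'd g x = 'd f x :> (V -> W) by exact: diff_unique.
by apply/diff_locallyP; rewrite dg.
Qed.

Lemma Ck_eq (V W : normedModType R) k (U : set V) (f g : V -> W) :
  open U -> (forall x, U x -> f x = g x) -> Ck k U f -> Ck k U g.
Proof.
move=> oU; elim: k f g => [|k IH] f g fg /=.
  move=> cf x Ux; have nfg : {near x, f =1 g}.
    by apply: filterS (open_nbhs_nbhs (conj oU Ux)) => y; exact: fg.
  rewrite /prop_for /continuous_at -(fg _ Ux).
  by apply: cvg_trans (cf _ Ux); apply: near_eq_cvg.
have nfg x : U x -> {near x, f =1 g}.
  by move=> Ux; apply: filterS (open_nbhs_nbhs (conj oU Ux)) => y; exact: fg.
case=> df Df; split=> [x Ux|v].
  by apply: differentiable_near_eq (df _ Ux); exact: nfg.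
by apply: IH (Df v) => x Ux; apply: near_eq_derive; exact: nfg.
Qed.

Lemma Ck_cst (V W : normedModType R) k (U : set V) (c : W) : Ck k U (cst c).
Proof.
elim: k c => [|k IH] c /=; first by move=> x _; exact: cst_continuous.
split=> [x _|v]; first exact: differentiable_cst.
rewrite (_ : (fun x => _) = cst 0); first exact: IH.
by apply/funext => x; rewrite derive_cst.
Qed.

Lemma smooth_id (V : normedModType R) (U : set V) : smooth_on U (@id V).
Proof.
move=> [|k] /=; first by move=> x _.
split=> [x _|v]; first by have [] := is_diff_id x.
rewrite (_ : (fun x => _) = cst v); first exact: Ck_cst.
by apply/funext => x; rewrite derive_id.
Qed.

Lemma Ck_prod (V V' W W' : normedModType R) k (U : set V) (U' : set V')
    (f : V -> W) (g : V' -> W') : open U -> open U' ->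
  Ck k U f -> Ck k U' g ->
  Ck k (U `*` U') (fun p : V * V' => (f p.1, g p.2)).
Proof.
move=> oU oU'.
have oUU' : open (U `*` U').
  rewrite openE => -[x y] [/= Ux Uy]; exists (U, U') => //=; split;
  exact: open_nbhs_nbhs.
elim: k f g => [|k IH] f g /=.
  move=> cf cg [x y] [/= Ux Uy].
  apply: cvg_pair => /=.
    by apply: cvg_comp; [exact: cvg_fst|exact: cf].
  by apply: cvg_comp; [exact: cvg_snd|exact: cg].
case=> df Df [dg Dg].
have is_fst p : is_diff p (fst : V * V' -> V) fst.
  have c : continuous (fst : V * V' -> V) by move=> q; exact: cvg_fst.
  by split; [exact: linear_differentiable|exact: diff_lin].
have is_snd p : is_diff p (snd : V * V' -> V') snd.
  have c : continuous (snd : V * V' -> V') by move=> q; exact: cvg_snd.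
  by split; [exact: linear_differentiable|exact: diff_lin].
have dfst p : U p.1 -> is_diff p (fun q : V * V' => f q.1) ('d f (p.1) \o fst).
  move=> Up; apply: (is_diff_comp (is_fst p)).
  by apply: differentiableP; exact: df.
have dsnd p : U' p.2 -> is_diff p (fun q : V * V' => g q.2) ('d g (p.2) \o snd).
  move=> Up; apply: (is_diff_comp (is_snd p)).
  by apply: differentiableP; exact: dg.
have dpair p : (U `*` U') p ->
    is_diff p (fun q : V * V' => (f q.1, g q.2))
              (fun v => ('d f (p.1) v.1, 'd g (p.2) v.2)).
  by case=> Up Up'; apply: is_diff_pair; [exact: dfst|exact: dsnd].
split=> [p Up|v]; first by have [] := dpair p Up.
apply: (Ck_eq oUU' _ (IH _ _ (Df v.1) (Dg v.2))) => p Up.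
have [dp dE] := dpair p Up; case: Up => Up Up'.
rewrite [RHS]deriveE // dE !deriveE //; [exact: dg|exact: df].
Qed.

End SmoothMaps.

(* Smooth manifolds modelled on E, up to the separation and countability
   axioms; [chart_at] chooses a chart around every point, and [point c] is the
   inverse of the coordinate map [coord c] of the chart [c]. *)
Record smoothSpace (R : realType) (E : normedModType R) := SmoothSpace {
  carrier :> topologicalType;
  chart : Type;
  dom : chart -> set carrier;
  coord : chart -> carrier -> E;
  point : chart -> E -> carrier;
  chart_at : carrier -> chart;
  dom_chart_at : forall p, dom (chart_at p) p;
  dom_open : forall c, open (dom c);
  img_open : forall c, open (coord c @` dom c);
  coordK : forall c p, dom c p -> point c (coord c p) = p;
  coord_continuous : forall c p, dom c p -> {for p, continuous (coord c)};
  point_continuous : forall c y, (coord c @` dom c) y ->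
    {for y, continuous (point c)};
  transition_smooth : forall c d,
    smooth_on [set y | (coord c @` dom c) y /\ dom d (point c y)]
              (coord d \o point c)
}.

Definition img (R : realType) (E : normedModType R) (M : smoothSpace E)
  (c : chart M) : set E := coord c @` dom c.

Section Product.
Context {R : realType} {E F : normedModType R}.
Variables (M : smoothSpace E) (N : smoothSpace F).

Let pdom (c : chart M * chart N) : set (M * N) := dom c.1 `*` dom c.2.
Let pcoord (c : chart M * chart N) (p : M * N) : E * F :=
  (coord c.1 p.1, coord c.2 p.2).
Let ppoint (c : chart M * chart N) (y : E * F) : M * N :=
  (point c.1 y.1, point c.2 y.2).

Let open_setX (S T : topologicalType) (A : set S) (B : set T) :
  open A -> open B -> open (A `*` B).
Proof.
move=> oA oB; rewrite openE => -[x y] [/= Ax By]; exists (A, B) => //=.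
by split; exact: open_nbhs_nbhs.
Qed.

Let continuous_prod (S S' T T' : topologicalType) (f : S -> T) (g : S' -> T')
    (p : S * S') : {for p.1, continuous f} -> {for p.2, continuous g} ->
  {for p, continuous (fun q : S * S' => (f q.1, g q.2))}.
Proof.
case: p => x y /= cf cg; apply: cvg_pair => /=.
  by apply: cvg_comp; [exact: cvg_fst|exact: cf].
by apply: cvg_comp; [exact: cvg_snd|exact: cg].
Qed.

Let pimgE c : pcoord c @` pdom c = img c.1 `*` img c.2.
Proof.
apply/seteqP; split=> [_ [p [? ?] <-]|[y z] [/= [a Da <-] [b Db <-]]].
  by split; [exists p.1|exists p.2].
by exists (a, b).
Qed.

Let overlap_open (E' : normedModType R) (M' : smoothSpace E') (c d : chart M') :
  open [set y | img c y /\ dom d (point c y)].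
Proof.
rewrite openE => y [cy dy].
have := point_continuous cy (open_nbhs_nbhs (conj (dom_open d) dy)).
have := open_nbhs_nbhs (conj (img_open c) cy).
exact: filterS2.
Qed.

Fact prod_dom_chart_at (p : M * N) : pdom (chart_at p.1, chart_at p.2) p.
Proof. by split; exact: dom_chart_at. Qed.

Fact prod_dom_open c : open (pdom c).
Proof. by apply: open_setX; exact: dom_open. Qed.

Fact prod_img_open c : open (pcoord c @` pdom c).
Proof. by rewrite pimgE; apply: open_setX; exact: img_open. Qed.

Fact prod_coordK c p : pdom c p -> ppoint c (pcoord c p) = p.
Proof.
by case: p => x y [/= Dx Dy]; rewrite /ppoint /pcoord /= !coordK.
Qed.

Fact prod_coord_continuous c p : pdom c p -> {for p, continuous (pcoord c)}.
Proof.
by case=> Dx Dy; apply: continuous_prod; exact: coord_continuous.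
Qed.

Fact prod_point_continuous c y : (pcoord c @` pdom c) y ->
  {for y, continuous (ppoint c)}.
Proof.
rewrite pimgE => -[Dx Dy].
by apply: continuous_prod; exact: point_continuous.
Qed.

Fact prod_transition_smooth c d :
  smooth_on [set y | (pcoord c @` pdom c) y /\ pdom d (ppoint c y)]
            (pcoord d \o ppoint c).
Proof.
move=> k; rewrite pimgE.
rewrite (_ : [set _ | _] = [set y | img c.1 y /\ dom d.1 (point c.1 y)] `*`
                           [set y | img c.2 y /\ dom d.2 (point c.2 y)]).
  apply: (@Ck_prod _ _ _ _ _ k _ _ (coord d.1 \o point c.1)
                                   (coord d.2 \o point c.2)).
  - exact: overlap_open.
  - exact: overlap_open.
  - exact: transition_smooth.
  - exact: transition_smooth.
by apply/seteqP; split=> -[y z] /=; case=> -[? ?] [? ?].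
Qed.

Definition prod_space : smoothSpace (E * F)%type :=
  SmoothSpace prod_dom_chart_at prod_dom_open prod_img_open prod_coordK
    prod_coord_continuous prod_point_continuous prod_transition_smooth.

End Product.

(* The manifold of positive reals, with the inclusion into R as only chart. *)
Section PositiveReals.
Variable R : realType.

Definition posreals : topologicalType := set_type [set x : R | 0 < x].

Definition posval (s : posreals) : R := set_val s.

Lemma posval_gt0 s : 0 < posval s.
Proof. exact: (set_mem (valP s)). Qed.

Definition topos (y : R) : posreals :=
  if pselect (0 < y) is left h then exist _ y (mem_set h)
  else exist _ 1 (mem_set (@ltr01 R : [set x : R | 0 < x] 1)).

Lemma toposK y : 0 < y -> posval (topos y) = y.
Proof. by rewrite /topos /posval set_valE; case: pselect. Qed.

Lemma posvalK s : topos (posval s) = s.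
Proof.
apply: val_inj; rewrite -[LHS]/(posval _ ) toposK ?posval_gt0//.
Qed.

Let pimgE : posval @` setT = [set y | 0 < y].
Proof.
apply/seteqP; split=> [_ [s _ <-]|y /= y0]; first exact: posval_gt0.
by exists (topos y) => //; rewrite toposK.
Qed.

Fact pos_img_open (c : unit) : open (posval @` setT).
Proof. by rewrite pimgE; exact: open_gt. Qed.

Fact pos_coord_continuous (c : unit) (s : posreals) :
  setT s -> {for s, continuous posval}.
Proof. by move=> _; exact: initial_continuous. Qed.

Fact pos_point_continuous (c : unit) y : (posval @` setT) y ->
  {for y, continuous topos}.
Proof.
rewrite pimgE => y0 U [_ [[W oW <-]]] /= Wy WU.
have oW0 : open (W `&` [set z : R | 0 < z]) by apply: openI => //; exact: open_gt.
have Wy0 : (W `&` [set z : R | 0 < z]) y by split=> //; rewrite -(toposK y0).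
apply: filterS (open_nbhs_nbhs (conj oW0 Wy0)) => z [Wz z0].
by apply: WU => /=; rewrite -/(posval _) toposK.
Qed.

Fact pos_transition_smooth (c d : unit) :
  smooth_on [set y | (posval @` setT) y /\ setT (topos y)] (posval \o topos).
Proof.
move=> k; rewrite pimgE.
rewrite (_ : [set _ | _] = [set y | 0 < y]).
  apply: (Ck_eq _ _ (smooth_id _ k)); first exact: open_gt.
  by move=> y y0; rewrite /= toposK.
by apply/seteqP; split=> [y []|y].
Qed.

Definition Rplus : smoothSpace R :=
  @SmoothSpace R R posreals unit (fun=> setT) (fun=> posval) (fun=> topos)
    (fun=> tt) (fun=> I) (fun=> openT) pos_img_open (fun _ s _ => posvalK s)
    pos_coord_continuous pos_point_continuous pos_transition_smooth.

End PositiveReals.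

Definition lin_span (R : realType) (V : lmodType R) (S : set V) : set V :=
  [set w | exists (k : nat) (a : 'I_k -> R) (u : 'I_k -> V),
     (forall i, S (u i)) /\ w = \sum_i a i *: u i].

Definition direct_sum (R : realType) (V : lmodType R) (A B : set V) :=
  (forall x, exists a b, [/\ A a, B b & x = a + b]) /\
  (forall x, A x -> B x -> x = 0).

(* The tangent space at p is identified with the model space E by means of the
   chart [chart_at p].  Accordingly, a vector field is a map M -> E, a 1-form a
   map M -> E -> R, a bilinear tensor a map M -> E -> E -> R, and a bundle
   endomorphism of TM a map M -> E -> E. *)
Section Tensors.
Context {R : realType} {E : normedModType R} (M : smoothSpace E).

(* components in the chart c of the tangent vector v at p *)
Definition tcoord (c : chart M) (p : M) (v : E) : E :=
  'D_v (coord c \o point (chart_at p)) (coord (chart_at p) p).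

(* the tangent vector at p whose components in the chart c are v *)
Definition tvec (c : chart M) (p : M) (v : E) : E :=
  'D_v (coord (chart_at p) \o point c) (coord c p).

Definition vfield := M -> E.

Definition vf_in_chart (c : chart M) (X : vfield) (y : E) : E :=
  tcoord c (point c y) (X (point c y)).

Definition smooth_vf (X : vfield) :=
  forall c : chart M, smooth_on (img c) (vf_in_chart c X).

Definition vf_deriv (X : vfield) (f : M -> R) (p : M) : R :=
  'D_(X p) (f \o point (chart_at p)) (coord (chart_at p) p).

Definition lie_bracket (X Y : vfield) : vfield := fun p =>
  let c := chart_at p in
  'D_(X p) (vf_in_chart c Y) (coord c p) - 'D_(Y p) (vf_in_chart c X) (coord c p).

Definition one_form (alpha : M -> E -> R) :=
  (forall p, scalar (alpha p)) /\
  (forall (c : chart M) (v : E),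
     smooth_on (img c) (fun y => alpha (point c y) (tvec c (point c y) v))).

Definition riemannian_metric (g : M -> E -> E -> R) :=
  [/\ forall p u, scalar (g p u),
      forall p u v, g p u v = g p v u,
      forall p v, v != 0 -> 0 < g p v v
    & forall (c : chart M) (u v : E),
        smooth_on (img c) (fun y => g (point c y) (tvec c (point c y) u)
                                                  (tvec c (point c y) v))].

Definition app_field (J : M -> E -> E) (X : vfield) : vfield :=
  fun p => J p (X p).

Definition tensor11 (J : M -> E -> E) :=
  (forall p, linear (J p)) /\
  (forall X, smooth_vf X -> smooth_vf (app_field J X)).

Definition ext_deriv (alpha : M -> E -> R) (X Y : vfield) (p : M) : R :=
  vf_deriv X (fun q => alpha q (Y q)) p - vf_deriv Y (fun q => alpha q (X q)) p
  - alpha p (lie_bracket X Y p).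

Definition wedge1 (alpha beta : M -> E -> R) (X Y : vfield) (p : M) : R :=
  alpha p (X p) * beta p (Y p) - alpha p (Y p) * beta p (X p).

(* k-forms, as alternating functions of k vector fields; for k = l = 1, [wedge]
   is [wedge1] *)
Definition form (k : nat) := ('I_k -> vfield) -> M -> R.

Definition wedge (k l : nat) (a : form k) (b : form l) : form (k + l) :=
  fun X p => (k`! * l`!)%:R^-1 *
    \sum_(s : 'S_(k + l)) (-1) ^+ s *
      (a (fun i => X (s (lshift l i))) p * b (fun j => X (s (rshift k j))) p).

Fixpoint wedge_exp (b : form 2) (m : nat) : form (m * 2) :=
  match m with
  | 0 => fun _ _ => 1
  | m'.+1 => wedge b (@wedge_exp b m')
  end.

Definition contact_volume (eta : M -> E -> R) (m : nat) : form (1 + m * 2) :=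
  wedge (fun X : 'I_1 -> vfield => fun p => eta p (X ord0 p))
        (@wedge_exp (fun X => ext_deriv eta (X ord0) (X ord_max)) m).

(* C = ker eta *)
Definition in_ker (eta : M -> E -> R) (X : vfield) :=
  smooth_vf X /\ forall p, eta p (X p) = 0.

(* phi : C -> C with phi^2 = -id; the values of phi outside C are irrelevant *)
Definition complex_structure (eta : M -> E -> R) (phi : M -> E -> E) :=
  [/\ forall p v, eta p v = 0 -> eta p (phi p v) = 0,
      forall p a u v, eta p u = 0 -> eta p v = 0 ->
        phi p (a *: u + v) = a *: phi p u + phi p v,
      forall X, in_ker eta X -> smooth_vf (app_field phi X)
    & forall p v, eta p v = 0 -> phi p (phi p v) = - v].

Definition levi_structure (eta : M -> E -> R) (phi : M -> E -> E) :=
  [/\ complex_structure eta phi,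
      forall X Y, in_ker eta X -> in_ker eta Y -> forall p,
        ext_deriv eta X (app_field phi Y) p = ext_deriv eta Y (app_field phi X) p
    & forall X, in_ker eta X -> forall p, X p != 0 ->
        0 < ext_deriv eta X (app_field phi X) p].

End Tensors.

Arguments wedge_exp {R E M} b m.
Arguments contact_volume {R E M} eta m.

Definition contact_form (R : realType) (n : nat)
    (M : smoothSpace 'rV[R]_(n * 2).+1) (eta : M -> 'rV[R]_(n * 2).+1 -> R) :=
  one_form eta /\
  forall p, exists X : 'I_(1 + n * 2) -> vfield M,
    (forall i, smooth_vf (X i)) /\ contact_volume eta n X p != 0.

(* The trivial bundle M x R_+: its tangent space at (x, s) is E * R, where the
   second component is the coefficient of the coordinate field of s. *)
Section TrivialBundle.
Context {R : realType} {E : normedModType R} (M : smoothSpace E).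

Definition bundle : smoothSpace (E * R)%type := prod_space M (Rplus R).

Definition fiber (q : bundle) : R := posval q.2.

Definition ds (q : bundle) (v : E * R) : R := v.2.

Definition nabla : vfield bundle := fun q => (0, fiber q).

Definition pullback (alpha : M -> E -> R) (q : bundle) (v : E * R) : R :=
  alpha q.1 v.1.

Definition lift (X : vfield M) : vfield bundle := fun q => (X q.1, 0).

Definition hlift (mu : M -> E -> R) (X : vfield M) : vfield bundle :=
  fun q => lift X q - mu q.1 (X q.1) *: nabla q.

(* C^h *)
Definition hker (eta mu : M -> E -> R) (q : bundle) : set (E * R)%type :=
  lin_span [set w | exists2 X, in_ker eta X & w = hlift mu X q].

Definition omega (eta : M -> E -> R) (X Y : vfield bundle) (q : bundle) : R :=
  wedge1 ds (pullback eta) X Y q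
  + fiber q * ext_deriv (pullback eta) X Y q.

Definition connection (mu : M -> E -> R) (q : bundle) (v : E * R) : R :=
  ds q v / fiber q + pullback mu q v.

Definition bundle_metric (mu : M -> E -> R) (gM : M -> E -> E -> R)
    (q : bundle) (u v : E * R) : R :=
  fiber q * (connection mu q u * connection mu q v + gM q.1 u.1 v.1).

End TrivialBundle.

(* Main.v *)
(* The exterior derivative of a 1-form is tensorial, so everything reduces to
   linear algebra in one tangent space, provided every tangent vector, and every
   vector of C, is the value of a global smooth field, resp. a global section of
   C.  No bump functions are needed for this: where the contact volume form does
   not vanish on global fields X_i, these span the tangent space, and
   eta(Z) X - eta(X) Z turns global fields into sections of C.
   At a point, g is definite, hence omega is nondegenerate.  Pairing with nabla
   gives eta((J nabla)_M) = 1 and J(C^h) in ker eta, and J^2 = -id makes J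
   g-skew, so that the vertical part of J x is -eta(x): thus J nabla and J(C^h)
   are horizontal.  Conversely J^2 = -id holds on nabla, on J nabla and on C^h,
   which together span.  Finally J commutes with the scaling of the fibers, so
   phi_C and A do not depend on s. *)

From Pilot Require Import Defs.
From HB Require Import structures.
From mathcomp Require Import all_boot all_order all_algebra perm.
From mathcomp Require Import all_classical all_reals all_analysis.
From mathcomp Require Import ring lra.
Import Order.TTheory GRing.Theory Num.Theory.
Import numFieldNormedType.Exports.
Local Open Scope classical_set_scope.
Local Open Scope ring_scope.

Set Implicit Arguments.
Unset Strict Implicit.
Unset Printing Implicit Defensive.

(** * Calculus of C^k maps *)

Section CkCalculus.
Context {R : realType}.
Implicit Types V W : normedModType R.

Lemma is_diff_linear V W (L : V -> W) x :
  linear L -> continuous L -> is_diff x L L.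
Proof.
move=> lL cL.
pose L' : {linear V -> W} := HB.pack L (GRing.isLinear.Build _ _ _ _ L lL).
by split; [exact: (@linear_differentiable _ _ _ L')|exact: (@diff_lin _ _ _ L')].
Qed.

Lemma is_diff_derive V W (f df : V -> W) x v : is_diff x f df -> 'D_v f x = df v.
Proof. by case=> fx dfE; rewrite deriveE // dfE. Qed.

Lemma derive_comp_linear V W W' (L : W -> W') (f : V -> W) x v :
  linear L -> continuous L -> differentiable f x ->
  'D_v (L \o f) x = L ('D_v f x).
Proof.
move=> lL cL fx.
have h := is_diff_comp (differentiableP fx) (is_diff_linear (f x) lL cL).
by rewrite (is_diff_derive v h) /= deriveE.
Qed.

Lemma is_derive_fsum V W (I : finType) (h : I -> V -> W) (dh : I -> W) x v :
  (forall i, is_derive x v (h i) (dh i)) ->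
  is_derive x v (fun y => \sum_i h i y) (\sum_i dh i).
Proof.
move=> dhE; suff gen (r : seq I) :
    is_derive x v (fun y => \sum_(i <- r) h i y) (\sum_(i <- r) dh i) by exact: gen.
elim: r => [|i r IH].
  rewrite big_nil (_ : (fun y => _) = cst 0); first exact: is_derive_cst.
  by apply/funext => y; rewrite big_nil.
rewrite big_cons (_ : (fun y => _) = h i + (fun y => \sum_(j <- r) h j y)).
  exact: is_deriveD.
by apply/funext => y; rewrite big_cons.
Qed.

Lemma derive_fsum V W (I : finType) (h : I -> V -> W) x v :
  (forall i, derivable (h i) x v) ->
  'D_v (fun y => \sum_i h i y) x = \sum_i 'D_v (h i) x.
Proof.
move=> dh; apply: derive_val; apply: is_derive_fsum => i; exact: derivableP.
Qed.

Lemma CkW V W k (U : set V) (f : V -> W) : Ck k.+1 U f -> Ck k U f.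
Proof.
elim: k f => [|k IH] f [df Df].
  by move=> x Ux; apply: differentiable_continuous; exact: df.
by split=> // v; exact: IH.
Qed.

Lemma CkD V W k (U : set V) (f g : V -> W) : open U ->
  Ck k U f -> Ck k U g -> Ck k U (fun x => f x + g x).
Proof.
move=> oU; elim: k f g => [|k IH] f g /=.
  by move=> cf cg x Ux; apply: cvgD; [exact: cf|exact: cg].
move=> [df Df] [dg Dg]; split=> [x Ux|v].
  by apply: differentiableD; [exact: df|exact: dg].
apply: (Ck_eq oU _ (IH _ _ (Df v) (Dg v))) => x Ux.
rewrite -[RHS]/('D_v (f + g) x) deriveD //; apply: diff_derivable.
  exact: df.
exact: dg.
Qed.

Lemma Ck_sum V W k (U : set V) (I : finType) (f : I -> V -> W) : open U ->
  (forall i, Ck k U (f i)) -> Ck k U (fun x => \sum_i f i x).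
Proof.
move=> oU Cf.
suff h (r : seq I) : Ck k U (fun x => \sum_(i <- r) f i x) by exact: h.
elim: r => [|i r IH].
  by apply: (Ck_eq oU _ (Ck_cst k U 0)) => x _; rewrite big_nil.
by apply: (Ck_eq oU _ (CkD oU (Cf i) IH)) => x _; rewrite big_cons.
Qed.

(** The product rule puts the undifferentiated factors back into the derivative, so the induction
    uses them at the lower order through [CkW]. *)
Lemma CkM V k (U : set V) (f g : V -> R) : open U ->
  Ck k U f -> Ck k U g -> Ck k U (fun x => f x * g x).
Proof.
move=> oU; elim: k f g => [|k IH] f g Cf Cg /=.
  by move=> x Ux; apply: cvgM; [exact: Cf|exact: Cg].
have [df Df] := Cf; have [dg Dg] := Cg; split=> [x Ux|v].
  by apply: differentiableM; [exact: df|exact: dg].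
apply: (Ck_eq oU _ (CkD oU (IH _ _ (CkW Cf) (Dg v)) (IH _ _ (CkW Cg) (Df v)))).
move=> x Ux; rewrite -[RHS]/('D_v (f * g) x) deriveM //; apply: diff_derivable.
  exact: df.
exact: dg.
Qed.

Lemma Ck_linear V W W' k (U : set V) (L : W -> W') (f : V -> W) : open U ->
  linear L -> continuous L -> Ck k U f -> Ck k U (L \o f).
Proof.
move=> oU lL cL; elim: k f => [|k IH] f /=.
  by move=> cf x Ux; apply: continuous_comp; [exact: cf|exact: cL].
move=> [df Df]; split=> [x Ux|v].
  apply: differentiable_comp; first exact: df.
  by have [] := is_diff_linear (f x) lL cL.
apply: (Ck_eq oU _ (IH _ (Df v))) => x Ux /=.
by rewrite derive_comp_linear //; exact: df.
Qed.

(** Since [dA] is the same at every point, the derivative of [f \o A] along v is that of f along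
    [dA v], composed with [A], and the induction closes without a general chain rule. The cases of
    interest are the projection to the base and the section s = 1. *)
Lemma Ck_affine V V' W k (U : set V) (U' : set V') (A dA : V' -> V)
    (f : V -> W) : open U' -> (forall y, is_diff y A dA) ->
  (forall y, U' y -> U (A y)) -> Ck k U f -> Ck k U' (f \o A).
Proof.
move=> oU' diffA AU; elim: k f => [|k IH] f /=.
  move=> cf y Uy; apply: continuous_comp; last exact/cf/AU.
  by apply: differentiable_continuous; have [] := diffA y.
move=> [df Df]; have dcomp y : U' y ->
    is_diff y (f \o A) ('d f (A y) \o dA).
  move=> Uy; apply: (is_diff_comp (diffA y)); apply: differentiableP.
  exact/df/AU.
split=> [y Uy|v]; first by have [] := dcomp y Uy.
apply: (Ck_eq oU' _ (IH _ (Df (dA v)))) => y Uy.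
by rewrite (is_diff_derive v (dcomp y Uy)) /= deriveE //; exact/df/AU.
Qed.

Lemma smooth_differentiable V W (U : set V) (f : V -> W) x :
  smooth_on U f -> U x -> differentiable f x.
Proof. by move=> /(_ 1%N) [df _]; exact: df. Qed.

End CkCalculus.

(** Finite-dimensionality in a form that passes to products: vector-valued maps and 1-forms expand
    into finite sums of scalar products, which reduces their smoothness to [CkM]. *)
Record frame (R : realType) (E : normedModType R) := Frame {
  frame_index : finType;
  fvec : frame_index -> E;
  fcoef : frame_index -> E -> R;
  fcoef_linear : forall i, scalar (fcoef i);
  fcoef_continuous : forall i, continuous (fcoef i);
  frameE : forall v, v = \sum_i fcoef i v *: fvec i
}.

Section Frames.
Context {R : realType}.

Program Definition rV_frame (m : nat) : frame 'rV[R]_m.+1 :=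
  @Frame R 'rV[R]_m.+1 _ (fun i : 'I_m.+1 => delta_mx 0 i)
    (fun i v => v 0 i) _ _ _.
Next Obligation. by move=> m i a u v; rewrite !mxE. Qed.
Next Obligation. by move=> m i; exact: coord_continuous. Qed.
Next Obligation. by move=> m v; exact: row_sum_delta. Qed.

Program Definition prod_frame (E F : normedModType R) (e : frame E) (f : frame F) :
    frame (E * F)%type :=
  @Frame R (E * F)%type (frame_index e + frame_index f)%type
    (fun i => match i with inl i => (fvec i, 0) | inr j => (0, fvec j) end)
    (fun i v => match i with inl i => fcoef i v.1 | inr j => fcoef j v.2 end)
    _ _ _.
Next Obligation. by move=> E F e f [i|i] a u v; exact: fcoef_linear. Qed.
Next Obligation.
move=> E F e f [i|i] p /=.
  by apply: continuous_comp; [exact: cvg_fst|exact: fcoef_continuous].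
by apply: continuous_comp; [exact: cvg_snd|exact: fcoef_continuous].
Qed.
Next Obligation.
move=> E F e f [u v]; rewrite big_sumType /=.
rewrite {1}(frameE e u) {1}(frameE f v).
have fstE I (r : seq I) (w : I -> E * F) :
    (\sum_(i <- r) w i).1 = \sum_(i <- r) (w i).1.
  exact: (big_morph fst).
have sndE I (r : seq I) (w : I -> E * F) :
    (\sum_(i <- r) w i).2 = \sum_(i <- r) (w i).2.
  exact: (big_morph snd).
apply/eqP; rewrite xpair_eqE /= !fstE !sndE /=; apply/andP; split; apply/eqP.
  rewrite [X in _ + X]big1 ?addr0 // => i _; exact: scaler0.
rewrite [X in X + _]big1 ?add0r // => i _; exact: scaler0.
Qed.

Program Definition R_frame : frame R :=
  @Frame R R unit (fun=> 1) (fun _ v => v) _ _ _.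
Next Obligation. by move=> i a u v. Qed.
Next Obligation. by move=> i v. Qed.
Next Obligation.
by move=> v; rewrite (big_pred1 tt) => [|[]//]; rewrite [RHS]mulr1.
Qed.

End Frames.

(** * Tensor calculus in charts *)

(* Restores coord, point and lift, which MathComp shadows. *)
Import Pilot.Defs.

Section Charts.
Context {R : realType} {E : normedModType R} {M : smoothSpace E}.
Implicit Types (c d : chart M) (p : M) (X Y : vfield M) (alpha : M -> E -> R).

Lemma coord_img c p : dom c p -> img c (coord c p).
Proof. by move=> cp; exists p. Qed.

Lemma point_dom c y : img c y -> dom c (point c y).
Proof. by case=> p cp <-; rewrite coordK. Qed.

Lemma pointK c y : img c y -> coord c (point c y) = y.
Proof. by case=> p cp <-; rewrite coordK. Qed.

Lemma open_img c : open (img c).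
Proof. exact: img_open. Qed.

Lemma near_img c y : img c y -> \forall z \near y, img c z.
Proof. by move=> cy; apply: open_nbhs_nbhs (conj (open_img c) cy). Qed.

Lemma near_dom c d p : dom c p -> dom d p ->
  \forall y \near coord c p, img c y /\ dom d (point c y).
Proof.
move=> cp dp; have cy := coord_img cp.
apply: filterI; first exact: near_img.
apply: (point_continuous cy); rewrite coordK //.
exact: (open_nbhs_nbhs (conj (dom_open d) dp)).
Qed.

Lemma transition_differentiable c d p : dom c p -> dom d p ->
  differentiable (coord d \o point c) (coord c p).
Proof.
move=> cp dp; apply: smooth_differentiable (transition_smooth c d) _.
by split; [exact: coord_img|rewrite coordK].
Qed.

(** Chain rule for the two opposite transition maps, whose composite is the identity near the
    point. *)
Lemma transitionK c d p v : dom c p -> dom d p ->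
  'D_('D_v (coord d \o point c) (coord c p)) (coord c \o point d) (coord d p) = v.
Proof.
move=> cp dp; have cd := transition_differentiable cp dp.
have dc := transition_differentiable dp cp.
have dc' : differentiable (coord c \o point d) ((coord d \o point c) (coord c p)).
  by rewrite /= coordK.
have h := is_diff_comp (differentiableP cd) (differentiableP dc').
rewrite !deriveE //; have := is_diff_derive v h.
rewrite /= coordK // => <-.
rewrite -[RHS](derive_id (coord c p)); apply: near_eq_derive.
by apply: filterS (near_dom cp dp) => y [cy dy] /=; rewrite coordK // pointK.
Qed.

Lemma tcoord_linear c p : dom c p -> linear (tcoord c p).
Proof.
move=> cp a u v; rewrite /tcoord.
have df := transition_differentiable (dom_chart_at p) cp.
by rewrite !deriveE // linearP.
Qed.

Lemma tvec_linear c p : dom c p -> linear (tvec c p).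
Proof.
move=> cp a u v; rewrite /tvec.
have df := transition_differentiable cp (dom_chart_at p).
by rewrite !deriveE // linearP.
Qed.

Lemma tcoordK c p : dom c p -> cancel (tcoord c p) (tvec c p).
Proof. by move=> cp v; apply: transitionK => //; exact: dom_chart_at. Qed.

(** The transition map from [chart_at p] to itself is locally the identity. This agrees with the use
    of that chart to identify the tangent space with the model space. *)
Lemma tcoord_chart_at p v : tcoord (chart_at p) p v = v.
Proof.
have cp := dom_chart_at p; rewrite /tcoord -[RHS](derive_id (coord (chart_at p) p)).
apply: near_eq_derive.
by apply: filterS (near_dom cp cp) => y [cy _] /=; rewrite pointK.
Qed.

Lemma tvec_chart_at p v : tvec (chart_at p) p v = v.
Proof. by rewrite -[v in LHS](tcoord_chart_at p) tcoordK //; exact: dom_chart_at. Qed.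

Definition smooth_fun (f : M -> R) := forall c, smooth_on (img c) (f \o point c).

Lemma smooth_fun_cst a : smooth_fun (cst a).
Proof. by move=> c k; exact: Ck_cst. Qed.

Lemma smooth_vfD X Y : smooth_vf X -> smooth_vf Y -> smooth_vf (fun p => X p + Y p).
Proof.
move=> sX sY c k; apply: Ck_eq (open_img c) _ (CkD (open_img c) (sX c k) (sY c k)).
move=> y cy; have lin := tcoord_linear (point_dom cy).
by rewrite /vf_in_chart -[X _ in RHS]scale1r lin scale1r.
Qed.

Lemma smooth_vf0 : smooth_vf ((fun=> 0) : vfield M).
Proof.
move=> c k; apply: Ck_eq (open_img c) _ (Ck_cst k (img c) 0) => y cy.
have := tcoord_linear (point_dom cy) (-1) 0 0.
by rewrite /vf_in_chart scaler0 addr0 scaleN1r addNr.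
Qed.

Lemma smooth_vf_sum (I : finType) (X : I -> vfield M) :
  (forall i, smooth_vf (X i)) -> smooth_vf (fun p => \sum_i X i p).
Proof.
move=> sX; suff h (r : seq I) : smooth_vf (fun p => \sum_(i <- r) X i p) by exact: h.
elim: r => [|i r IH].
  have -> : (fun p => \sum_(i <- [::]) X i p) = (fun=> 0).
    by apply/funext => p; rewrite big_nil.
  exact: smooth_vf0.
have -> : (fun p => \sum_(j <- i :: r) X j p) = (fun p => X i p + \sum_(j <- r) X j p).
  by apply/funext => p; rewrite big_cons.
exact: smooth_vfD.
Qed.

(** The form read in the chart and evaluated on the field with constant components v, as a function
    of the coordinates y. *)
Definition local_coef alpha c (v y : E) : R :=
  alpha (point c y) (tvec c (point c y) v).

(** The exterior derivative as a tensor at p: its defining formula for the fields extending u and v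
    with constant components in the chart, whose bracket vanishes. *)
Definition dform alpha p (u v : E) : R :=
  let c := chart_at p in
  'D_u (local_coef alpha c v) (coord c p) - 'D_v (local_coef alpha c u) (coord c p).

Lemma dform_antisym alpha p u v : dform alpha p u v = - dform alpha p v u.
Proof. by rewrite /dform opprB. Qed.

Lemma local_coef_differentiable alpha c p v : one_form alpha -> dom c p ->
  differentiable (local_coef alpha c v) (coord c p).
Proof.
by case=> _ sa cp; apply: smooth_differentiable (sa c v) _; exact: coord_img.
Qed.

Lemma local_coef_linear alpha c y : one_form alpha -> img c y ->
  scalar (fun v => local_coef alpha c v y).
Proof.
case=> la _ cy a u v.
by rewrite /local_coef (tvec_linear (point_dom cy)) la.
Qed.

Lemma dform_linear alpha p u : one_form alpha -> scalar (dform alpha p u).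
Proof.
move=> fa a v w; rewrite /dform; set c := chart_at p.
have cp : dom c p := dom_chart_at p.
have df x := local_coef_differentiable x fa cp.
have -> : 'D_u (local_coef alpha c (a *: v + w)) (coord c p) =
    'D_u (a \*: local_coef alpha c v + local_coef alpha c w) (coord c p).
  apply: near_eq_derive; apply: filterS (near_img (coord_img cp)) => y cy.
  by rewrite (local_coef_linear fa cy).
have dv x y := @diff_derivable _ _ _ _ _ y (df x).
rewrite deriveD; [|exact: derivableZ|exact: dv].
rewrite deriveZ //; rewrite [X in _ - X](deriveE _ (df u)) linearP -!deriveE //.
by rewrite opprD addrACA -scalerBr.
Qed.

End Charts.

(** * Products and pairings in a frame; tensoriality of the exterior derivative *)

Section FramedCharts.
Context {R : realType} {E : normedModType R} (e : frame E).

Lemma frame_sum (F : E -> R) v : scalar F -> F v = \sum_i fcoef i v * F (@fvec _ _ e i).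
Proof.
move=> lF; pose F' : {linear E -> R} := HB.pack F (GRing.isLinear.Build _ _ _ _ F lF).
transitivity (F' (\sum_i fcoef i v *: @fvec _ _ e i)); first by rewrite -frameE.
by rewrite linear_sum; apply: eq_bigr => i _; rewrite linearZ.
Qed.

Lemma Ck_scale (V : normedModType R) k (U : set V) (f : V -> R) (F : V -> E) :
  open U -> Ck k U f -> Ck k U F -> Ck k U (fun x => f x *: F x).
Proof.
move=> oU Cf CF.
apply: (Ck_eq oU _ (Ck_sum (I := frame_index e)
  (f := fun i => (fun a => a *: fvec i) \o (fun x => f x * fcoef i (F x))) oU _)).
  by move=> x _; rewrite [F x in RHS](frameE e) scaler_sumr; apply: eq_bigr => i _;
     rewrite /= scalerA.
move=> i; apply: Ck_linear => //.
- by move=> a u v; rewrite /= scalerDl scalerA.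
- exact: scalel_continuous.
apply: CkM => //; apply: (Ck_linear (L := fcoef i)) => //.
  exact: fcoef_linear.
exact: fcoef_continuous.
Qed.

Context {M : smoothSpace E}.
Implicit Types (c : chart M) (p : M) (X Y : vfield M) (alpha : M -> E -> R).

Lemma smooth_vf_scale (f : M -> R) X : smooth_fun f -> smooth_vf X ->
  smooth_vf (fun p => f p *: X p).
Proof.
move=> sf sX c k.
apply: Ck_eq (open_img c) _ (Ck_scale (open_img c) (sf c k) (sX c k)) => y cy /=.
rewrite /vf_in_chart; have lin := tcoord_linear (point_dom cy).
have := lin (f (point c y)) (X (point c y)) 0.
have -> : tcoord c (point c y) 0 = 0 by rewrite /tcoord derive0.
by rewrite !addr0.
Qed.

Lemma local_coefE alpha X c y : one_form alpha -> img c y ->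
  alpha (point c y) (X (point c y)) =
  \sum_i fcoef i (vf_in_chart c X y) * local_coef alpha c (@fvec _ _ e i) y.
Proof.
move=> fa cy; rewrite -(frame_sum _ (local_coef_linear fa cy)) /local_coef.
by rewrite tcoordK //; exact: point_dom.
Qed.

Lemma smooth_fun_form alpha X : one_form alpha -> smooth_vf X ->
  smooth_fun (fun p => alpha p (X p)).
Proof.
move=> fa sX c k; have oc := open_img c.
apply: (Ck_eq oc (fun y cy => esym (local_coefE X fa cy))).
apply: Ck_sum => // i; apply: CkM => //; last by case: fa => _ /(_ c (fvec i) k).
apply: (Ck_linear (L := fcoef i)) => //; last exact: sX.
  exact: fcoef_linear.
exact: fcoef_continuous.
Qed.

(** Product rule for the pairing, expanded in the frame: the first term differentiates the form with
    the components of X frozen at p, the second differentiates the components of X. *)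
Lemma vf_deriv_form alpha X c p u : one_form alpha -> smooth_vf X -> dom c p ->
  'D_u ((fun q => alpha q (X q)) \o point c) (coord c p) =
  'D_u (local_coef alpha c (tcoord c p (X p))) (coord c p) +
  local_coef alpha c ('D_u (vf_in_chart c X) (coord c p)) (coord c p).
Proof.
move=> fa sX cp; have cy := coord_img cp.
have df x := local_coef_differentiable x fa cp.
have dX : differentiable (vf_in_chart c X) (coord c p).
  exact: smooth_differentiable (sX c) cy.
have Dl i : 'D_u (@fcoef _ _ e i \o vf_in_chart c X) (coord c p) =
    fcoef i ('D_u (vf_in_chart c X) (coord c p)).
  apply: derive_comp_linear dX; first exact: fcoef_linear.
  exact: fcoef_continuous.
have dl i : derivable (@fcoef _ _ e i \o vf_in_chart c X) (coord c p) u.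
  apply/diff_derivable/differentiable_comp => //.
  by have [] := is_diff_linear (vf_in_chart c X (coord c p)) (@fcoef_linear _ _ e i)
    (@fcoef_continuous _ _ _ i).
have da i : derivable (local_coef alpha c (@fvec _ _ e i)) (coord c p) u.
  exact: diff_derivable.
transitivity ('D_u (fun y => \sum_i ((@fcoef _ _ e i \o vf_in_chart c X)
    * local_coef alpha c (@fvec _ _ e i)) y) (coord c p)).
  apply: near_eq_derive; apply: filterS (near_img cy) => y iy /=.
  by rewrite (local_coefE X fa iy).
rewrite derive_fsum; last by move=> i; exact: derivableM.
have -> : 'D_u (local_coef alpha c (tcoord c p (X p))) (coord c p) =
    'D_u (fun y => \sum_i (@fcoef _ _ e i (tcoord c p (X p)) \*:
      local_coef alpha c (@fvec _ _ e i)) y) (coord c p).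
  apply: near_eq_derive; apply: filterS (near_img cy) => y iy /=.
  by rewrite (frame_sum _ (local_coef_linear fa iy)).
rewrite derive_fsum; last by move=> i; exact: derivableZ.
rewrite (frame_sum _ (local_coef_linear fa cy)) -big_split /=.
apply: eq_bigr => i _; rewrite deriveM // deriveZ //= Dl /vf_in_chart coordK //.
by congr (_ + _); rewrite [LHS]mulrC.
Qed.

(** The terms of the product rule that differentiate X and Y add up to the form on the Lie bracket
    and cancel against it; the rest involves only the values at p. *)
Lemma ext_derivE alpha X Y p : one_form alpha -> smooth_vf X -> smooth_vf Y ->
  ext_deriv alpha X Y p = dform alpha p (X p) (Y p).
Proof.
move=> fa sX sY; rewrite /ext_deriv /vf_deriv /lie_bracket /dform.
set c := chart_at p; have cp : dom c p := dom_chart_at p.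
rewrite !vf_deriv_form // !tcoord_chart_at.
rewrite {2 4}/local_coef !coordK // !tvec_chart_at.
case: (fa) => la _.
have lB u v : alpha p (u - v) = alpha p u - alpha p v.
  by rewrite addrC -scaleN1r la mulN1r addrC.
rewrite lB; ring.
Qed.

End FramedCharts.

(** * Vector fields on the trivial bundle *)

Section Bundle.
Context {R : realType} {E : normedModType R} {M : smoothSpace E}.
Implicit Types (X : vfield M) (Z : vfield (bundle M)) (q : bundle M).

(** The global section s = 1, along which objects on the bundle are brought back to the base. *)
Definition slice (p : M) : bundle M := (p, topos (1 : R)).

Lemma fiber_slice p : fiber (slice p) = 1.
Proof. by rewrite /fiber /slice /= toposK. Qed.

Lemma fiber_gt0 q : 0 < fiber q.
Proof. exact: posval_gt0. Qed.

Lemma is_diff_fst (V W : normedModType R) (y : V * W) :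
  is_diff y (fst : V * W -> V) fst.
Proof. by apply: is_diff_linear => // z; exact: cvg_fst. Qed.

Lemma is_diff_snd (V W : normedModType R) (y : V * W) :
  is_diff y (snd : V * W -> W) snd.
Proof. by apply: is_diff_linear => // z; exact: cvg_snd. Qed.

Lemma img_bundle (c : chart (bundle M)) (y : E * R) :
  img c y <-> img (c.1 : chart M) y.1 /\ 0 < y.2.
Proof.
split=> [[[p s] [/= cp _] <-]|[[p cp py] y0]].
  by split; [exists p|exact: posval_gt0].
exists (p, topos y.2); first by split.
by case: y py y0 => /= y t <- t0; rewrite /= toposK.
Qed.

(** The fiber has a single chart, so a transition map of the bundle is a transition map of the base
    times the identity of the positive reals. *)
Lemma transition_bundle (c d : chart (bundle M)) q v :
  dom (c.1 : chart M) q.1 -> dom (d.1 : chart M) q.1 ->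
  'D_v (coord d \o point c) (coord c q) =
  ('D_(v.1) (coord (d.1 : chart M) \o point (c.1 : chart M)) (coord c.1 q.1), v.2).
Proof.
move=> cq dq.
have cd := transition_differentiable cq dq.
have hf := is_diff_comp (is_diff_fst (coord c q)) (differentiableP cd).
have h := is_diff_pair hf (is_diff_snd (coord c q)).
have := is_diff_derive v h; rewrite /= -deriveE // => <-.
have cq' : dom c q by split.
apply: near_eq_derive; apply: filterS (near_img (coord_img cq')) => -[y t].
by move=> /img_bundle [/= _ t0]; rewrite /= toposK.
Qed.

Lemma tcoord_bundle (c : chart (bundle M)) q v : dom (c.1 : chart M) q.1 ->
  tcoord c q v = (tcoord (c.1 : chart M) q.1 v.1, v.2).
Proof. by move=> cq; apply: transition_bundle => //; exact: dom_chart_at. Qed.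

Lemma tvec_bundle (c : chart (bundle M)) q v : dom (c.1 : chart M) q.1 ->
  tvec c q v = (tvec (c.1 : chart M) q.1 v.1, v.2).
Proof. by move=> cq; apply: transition_bundle => //; exact: dom_chart_at. Qed.

Lemma Ck_base (W : normedModType R) (c : chart (bundle M)) k (f : E -> W) :
  Ck k (img (c.1 : chart M)) f -> Ck k (img c) (f \o fst).
Proof.
apply: Ck_affine; first exact: open_img.
  by move=> y; exact: is_diff_fst.
by move=> y /img_bundle [].
Qed.

Lemma smooth_fun_base (f : M -> R) : smooth_fun f ->
  smooth_fun (fun q : bundle M => f q.1).
Proof. by move=> sf c k; have := @Ck_base _ c k _ (sf c.1 k). Qed.

Lemma one_form_pullback (alpha : M -> E -> R) :
  one_form alpha -> one_form (@pullback R E M alpha).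
Proof.
case=> la sa; split=> [q a u v|c v k]; first exact: la.
apply: (Ck_eq (open_img c) _ (Ck_base (sa c.1 v.1 k))) => y /img_bundle [cy _].
by rewrite /pullback /= tvec_bundle //; exact: point_dom.
Qed.

(** In a product chart the coefficients of a pullback do not depend on s and ignore the vertical
    component. *)
Lemma dform_pullback (alpha : M -> E -> R) q x y : one_form alpha ->
  dform (@pullback R E M alpha) q x y = dform alpha q.1 x.1 y.1.
Proof.
move=> fa.
have gen u v : 'D_u (local_coef (@pullback R E M alpha) (chart_at q) v)
     (coord (chart_at q) q) =
   'D_(u.1) (local_coef alpha (chart_at q.1) v.1) (coord (chart_at q.1) q.1).
  have da := local_coef_differentiable v.1 fa (dom_chart_at q.1).
  have h := is_diff_comp (is_diff_fst (coord (chart_at q) q)) (differentiableP da).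
  have := is_diff_derive u h; rewrite /= -deriveE // => <-.
  apply: near_eq_derive.
  apply: filterS (near_img (coord_img (dom_chart_at q))) => z /img_bundle [cz _].
  by rewrite /local_coef /pullback tvec_bundle //; exact: point_dom.
by rewrite /dform; congr (_ - _); exact: gen.
Qed.

Lemma smooth_lift X : smooth_vf X -> smooth_vf (lift X).
Proof.
move=> sX c k; have oc := open_img c.
have L : linear (fun u : E => (u, 0 : R)).
  by move=> a u v; apply: injective_projections => //=; rewrite scaler0 addr0.
have cL : continuous (fun u : E => (u, 0 : R)).
  move=> u; apply: differentiable_continuous.
  by have [] := is_diff_pair (is_diff_id u) (is_diff_cst (0 : R) u).
apply: (Ck_eq oc _ (Ck_linear oc L cL (Ck_base (sX c.1 k)))) => y /img_bundle [cy _].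
by rewrite /vf_in_chart /= tcoord_bundle //; exact: point_dom.
Qed.

Lemma smooth_nabla : smooth_vf (@nabla R E M).
Proof.
move=> c k; have oc := open_img c.
have L : linear (fun y : E * R => (0 : E, y.2)).
  by move=> a u v; apply: injective_projections => //=; rewrite scaler0 addr0.
have cL : continuous (fun y : E * R => (0 : E, y.2)).
  move=> u; apply: differentiable_continuous.
  by have [] := is_diff_pair (is_diff_cst (0 : E) u) (is_diff_snd u).
apply: (Ck_eq oc _ (Ck_linear oc L cL (smooth_id (img c) k))) => y /img_bundle [cy y0].
rewrite /vf_in_chart /= tcoord_bundle /=; last exact: point_dom.
by rewrite /tcoord derive0 /fiber /= toposK.
Qed.

(** In charts this is composition with the affine map sending z to (z, 1), followed by a projection.
    It will give the smoothness of A and of the images under phi_C. *)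
Lemma smooth_slice Z : smooth_vf Z -> smooth_vf (fun p => (Z (slice p)).1).
Proof.
move=> sZ c k; have oc := open_img c.
pose c' : chart (bundle M) := (c, tt).
have diffA (y : E) : is_diff y (fun z : E => (z, 1 : R)) (fun z : E => (z, 0 : R)).
  exact: is_diff_pair (is_diff_id y) (is_diff_cst (1 : R) y).
have cc y : img c y -> img c' (y, 1) by move=> cy; apply/img_bundle.
have fstC : continuous (fst : E * R -> E) by move=> z; exact: cvg_fst.
have := Ck_linear oc (_ : linear (fst : E * R -> E)) fstC
  (Ck_affine oc diffA cc (sZ c' k)).
move=> /(_ (fun _ _ _ => erefl)); apply: (Ck_eq oc) => y cy /=.
by rewrite /vf_in_chart tcoord_bundle //; exact: point_dom.
Qed.

End Bundle.

Section FramedBundle.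
Context {R : realType} {E : normedModType R} (e : frame E) {M : smoothSpace E}.
Implicit Types (X : vfield M) (Z : vfield (bundle M)) (q : bundle M).

Let be := prod_frame e (@R_frame R).

Lemma smooth_nabla_scale (f : M -> R) : smooth_fun f ->
  smooth_vf (fun q : bundle M => f q.1 *: nabla q).
Proof.
move=> sf; apply: (smooth_vf_scale be); last exact: smooth_nabla.
exact: smooth_fun_base.
Qed.

Lemma smooth_hlift (mu : M -> E -> R) X : one_form mu -> smooth_vf X ->
  smooth_vf (hlift mu X).
Proof.
move=> fmu sX.
have -> : hlift mu X = (fun q => lift X q + (-1 * mu q.1 (X q.1)) *: nabla q).
  by apply/funext => q; rewrite mulN1r scaleNr.
apply: smooth_vfD; first exact: smooth_lift.
apply: (@smooth_nabla_scale (fun p => -1 * mu p (X p))) => c k.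
apply: (CkM (open_img c) (Ck_cst k _ (-1 : R))).
exact: (smooth_fun_form e fmu sX).
Qed.

Lemma omegaE (eta : M -> E -> R) (X Y : vfield (bundle M)) q :
  one_form eta -> smooth_vf X -> smooth_vf Y ->
  omega eta X Y q = (X q).2 * eta q.1 (Y q).1 - (Y q).2 * eta q.1 (X q).1
    + fiber q * dform eta q.1 (X q).1 (Y q).1.
Proof.
move=> fe sX sY; rewrite /omega (ext_derivE be q (one_form_pullback fe) sX sY).
by rewrite dform_pullback.
Qed.

End FramedBundle.

(** * Global fields with prescribed values *)

Section Multilinear.
Context {R : realType} {E : normedModType R}.

Definition upd k (x : 'I_k -> E) i u : 'I_k -> E := fun j => if j == i then u else x j.

Definition multilin k (t : ('I_k -> E) -> R) :=
  forall x i a u v, t (upd x i (a *: u + v)) = a * t (upd x i u) + t (upd x i v).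

Definition alternating k (t : ('I_k -> E) -> R) :=
  forall x i j, i != j -> x i = x j -> t x = 0.

(** The pointwise counterpart of [wedge], with the same normalization, on tuples of tangent vectors
    instead of fields. *)
Definition twedge k l (ta : ('I_k -> E) -> R) (tb : ('I_l -> E) -> R)
    (x : 'I_(k + l) -> E) : R :=
  (k`! * l`!)%:R^-1 *
    \sum_(s : 'S_(k + l)) (-1) ^+ s *
      (ta (fun i => x (s (lshift l i))) * tb (fun j => x (s (rshift k j)))).

(** In the summand of s, slot i is read at the position s^-1(i), which belongs to exactly one of the
    two factors; linearity of that factor is used and the other stays constant. *)
Lemma multilin_twedge k l (ta : ('I_k -> E) -> R) (tb : ('I_l -> E) -> R) :
  multilin ta -> multilin tb -> multilin (twedge ta tb).
Proof.
move=> la lb x i a u v; rewrite /twedge (mulrCA a) -mulrDr; congr (_ * _).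
rewrite mulr_sumr -big_split /=; apply: eq_bigr => s _.
rewrite (mulrCA a) -mulrDr; congr (_ * _).
have sE z j : upd x i z (s j) = upd (x \o s) (perm_inv s i) z j.
  by rewrite /upd (can2_eq (permK s) (permKV s)).
have compE z m (f : 'I_m -> 'I_(k + l)) :
    (fun j => upd x i z (s (f j))) = (fun j => upd (x \o s) (perm_inv s i) z (f j)).
  by apply/funext => j; rewrite sE.
rewrite !compE.
case: (splitP (perm_inv s i)) => j ij.
  have lE z : (fun j' => upd (x \o s) (perm_inv s i) z (lshift l j')) =
      upd (fun j' => x (s (lshift l j'))) j z.
    apply/funext => j'; rewrite /upd (_ : perm_inv s i = lshift l j) ?eq_lshift //.
    exact: val_inj.
  have rE z : (fun j' => upd (x \o s) (perm_inv s i) z (rshift k j')) =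
      (fun j' => x (s (rshift k j'))).
    apply/funext => j'; rewrite /upd (_ : perm_inv s i = lshift l j) ?eq_rlshift //.
    exact: val_inj.
  by rewrite !lE !rE la mulrDl mulrA.
have lE z : (fun j' => upd (x \o s) (perm_inv s i) z (lshift l j')) =
    (fun j' => x (s (lshift l j'))).
  apply/funext => j'; rewrite /upd (_ : perm_inv s i = rshift k j) ?eq_lrshift //.
  exact: val_inj.
have rE z : (fun j' => upd (x \o s) (perm_inv s i) z (rshift k j')) =
    upd (fun j' => x (s (rshift k j'))) j z.
  apply/funext => j'; rewrite /upd (_ : perm_inv s i = rshift k j) ?eq_rshift //.
  exact: val_inj.
by rewrite !lE !rE lb mulrDr mulrCA.
Qed.

(* The sum over permutations antisymmetrizes, whatever the factors are. *)
Lemma alternating_twedge k l (ta : ('I_k -> E) -> R) (tb : ('I_l -> E) -> R) :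
  alternating (twedge ta tb).
Proof.
move=> x i j ij xij; rewrite /twedge; set S := \sum_s _.
have xt z : x (tperm i j z) = x z by case: tpermP => // ->.
have SN : S = - S.
  rewrite {1}/S (reindex_inj (mulIg (tperm i j))) /= -sumrN.
  apply: eq_bigr => s _; rewrite odd_permM odd_tperm ij addbT.
  rewrite signrN mulNr; congr (- (_ * (ta _ * tb _))).
    by apply/funext => z; rewrite permM xt.
  by apply/funext => z; rewrite permM xt.
have -> : S = 0 by lra.
by rewrite mulr0.
Qed.

Lemma multilin_sum k (t : ('I_k -> E) -> R) x i (m : nat)
    (a : 'I_m -> R) (v : 'I_m -> E) :
  multilin t -> t (upd x i (\sum_j a j *: v j)) = \sum_j a j * t (upd x i (v j)).
Proof.
move=> lt; have t0 : t (upd x i 0) = 0.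
  by have := lt x i (-1) 0 0; rewrite scaler0 addr0 mulN1r addNr.
elim/big_rec2: _ => // j s u _ IH; by rewrite lt IH.
Qed.

End Multilinear.

(** Given a linear relation with nonzero coefficient at j0, put it into slot j0: by alternation only
    that coefficient times [t v] survives, so [t v] would vanish. Hence the vectors are independent,
    and their number is the dimension. *)
Lemma alternating_span (R : realType) (m : nat) (t : ('I_m.+1 -> 'rV[R]_m.+1) -> R) v :
  multilin t -> alternating t -> t v != 0 ->
  forall w, exists a : 'I_m.+1 -> R, w = \sum_i a i *: v i.
Proof.
move=> lt at0 tv w; pose A := \matrix_i v i.
have : row_free A.
  rewrite -kermx_eq0; apply/negPn/negP => /matrix0Pn [i0 [j0 nz]].
  have : \sum_j kermx A i0 j *: v j = 0.
    have := congr1 (row i0) (mulmx_ker A); rewrite row_mul row0 mulmx_sum_row.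
    move=> h; apply: etrans h; apply: eq_bigr => j _; rewrite rowK !mxE //.
  move=> s0; move/eqP: tv; apply.
  have := multilin_sum v j0 (fun j => kermx A i0 j) v lt.
  have t0 : t (upd v j0 0) = 0.
    by have := lt v j0 (-1) 0 0; rewrite scaler0 addr0 mulN1r addNr.
  rewrite s0 t0 (bigD1 j0) //= big1 => [|j jj0]; last first.
    rewrite (at0 _ j0 j) ?mulr0 //; first by rewrite eq_sym.
    by rewrite /upd eqxx (negPf jj0).
  have -> : upd v j0 (v j0) = v.
    by apply/funext => j; rewrite /upd; case: eqP => // ->.
  by rewrite addr0 => /esym/eqP; rewrite mulf_eq0 (negPf nz) => /eqP.
rewrite row_free_unit -row_full_unit => fullA.
have /submxP [a wE] := submx_full w fullA.
exists (fun i => a 0 i); rewrite wE mulmx_sum_row.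
by apply: eq_bigr => i _; rewrite rowK.
Qed.

(** * Tensoriality of the contact volume form *)

Section ContactSpan.
Context {R : realType} {E : normedModType R} (e : frame E) {M : smoothSpace E}.

(** The value at p is compared with a tensor on smooth fields only, those for which [ext_derivE]
    gives the pointwise formula. *)
Definition tensor_at k (F : form M k) p (t : ('I_k -> E) -> R) :=
  multilin t /\
  forall X, (forall i, smooth_vf (X i)) -> F X p = t (fun i => X i p).

Lemma tensor_at_wedge k l (a : form M k) (b : form M l) p ta tb :
  tensor_at a p ta -> tensor_at b p tb -> tensor_at (wedge a b) p (twedge ta tb).
Proof.
move=> [la aE] [lb bE]; split; first exact: multilin_twedge.
move=> X sX; rewrite /wedge /twedge; congr (_ * _); apply: eq_bigr => s _.
by rewrite aE ?bE.
Qed.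

Lemma tensor_at_form alpha p : one_form alpha ->
  tensor_at (fun X : 'I_1 -> vfield M => fun p => alpha p (X ord0 p)) p
    (fun x => alpha p (x ord0)).
Proof.
case=> la _; split=> // x i a u v.
by rewrite /upd (ord1 i) eqxx la.
Qed.

Lemma tensor_at_ext_deriv alpha p : one_form alpha ->
  tensor_at (fun X : 'I_2 -> vfield M => ext_deriv alpha (X ord0) (X ord_max)) p
    (fun x => dform alpha p (x ord0) (x ord_max)).
Proof.
move=> fa; split=> [x i a u v|X sX]; last exact: (ext_derivE e).
have l0 : i = ord0 \/ i = ord_max.
  by case: i => -[|[|//]] ?; [left|right]; exact: val_inj.
rewrite /upd; case: l0 => -> /=; last exact: dform_linear.
rewrite !(dform_antisym _ _ _ (x _)) dform_linear //.
by rewrite opprD mulrN.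
Qed.

Lemma tensor_at_wedge_exp (b : form M 2) m p tb : tensor_at b p tb ->
  exists t, tensor_at (wedge_exp b m) p t.
Proof.
move=> hb; elim: m => [|m [t ht]].
  by exists (fun=> 1); split=> [x []|].
by exists (twedge tb t); exact: (tensor_at_wedge hb ht).
Qed.

End ContactSpan.

Section ContactFields.
Context {R : realType} {n : nat} {M : smoothSpace 'rV[R]_(n * 2).+1}.
Variable eta : M -> 'rV[R]_(n * 2).+1 -> R.
Hypothesis eta_contact : contact_form eta.

Let e := rV_frame (R := R) (n * 2).
Let feta : one_form eta := eta_contact.1.

(** The contact condition becomes the nonvanishing of one multilinear form at p. The factor eta
    stays explicit, so that eta itself can be shown nonzero at p. *)
Lemma contact_twedge p : exists t v,
  let T := @twedge R 'rV[R]_(n * 2).+1 1 (n * 2) (fun x => eta p (x ord0)) t in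
  [/\ multilin T, T (fun i => v i p) != 0 & forall i, smooth_vf (v i : vfield M)].
Proof.
have [X [sX nz]] := eta_contact.2 p.
have [t ht] := tensor_at_wedge_exp n (tensor_at_ext_deriv e p feta).
have [lT TE] := tensor_at_wedge (tensor_at_form p feta) ht.
by exists t, X; split=> //; rewrite -TE.
Qed.

(** The global fields detecting the contact volume at p span the tangent space there; a combination
    with constant coefficients takes the value w. *)
Lemma global_extension p w : exists2 X : vfield M, smooth_vf X & X p = w.
Proof.
have [t [v [lT nz sv]]] := contact_twedge p.
have aT := @alternating_twedge R 'rV[R]_(n * 2).+1 1 (n * 2) (fun x => eta p (x ord0)) t.
have [a ->] := alternating_span (m := n * 2) lT aT nz w.
exists (fun q => \sum_i a i *: v i q) => //.
apply: smooth_vf_sum => i; apply: (smooth_vf_scale e) => //.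
exact: smooth_fun_cst.
Qed.

(** Otherwise the first factor of every summand of the contact volume at p would be zero. *)
Lemma contact_neq0 p : exists w, eta p w != 0.
Proof.
apply/not_existsP => h; have [t [v [_ /eqP nz _]]] := contact_twedge p; apply: nz.
rewrite /twedge big1 ?mulr0 // => s _.
rewrite (_ : eta p _ = 0) ?mul0r ?mulr0 //.
by apply/eqP/negPn/negP; exact: h.
Qed.

Lemma ker_extension p w : eta p w = 0 -> exists2 X, in_ker eta X & X p = w.
Proof.
move=> w0; have [X sX XE] := global_extension p w.
have [z z0] := contact_neq0 p; have [Z sZ ZE] := global_extension p z.
have le := feta.1.
have lN q a u v : eta q (a *: u + v) = a * eta q u + eta q v := le q a u v.
(* The field eta(Z) X - eta(X) Z lies in C everywhere. At p its second term vanishes, and the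
   constant factor normalizes the first one to w. *)
exists (fun q => ((eta p z)^-1 * eta q (Z q)) *: X q +
                 (- ((eta p z)^-1) * eta q (X q)) *: Z q); last first.
  by rewrite XE ZE w0 mulr0 scale0r addr0 mulVf // scale1r.
split=> [|q]; last first.
  rewrite lN; have := lN q (- (eta p z)^-1 * eta q (X q)) (Z q) 0.
  have -> : eta q 0 = 0 by have := lN q (-1) 0 0; rewrite scaler0 addr0 mulN1r addNr.
  by rewrite !addr0 => ->; ring.
have sc a (f : M -> R) : smooth_fun f -> smooth_fun (fun q => a * f q).
  by move=> sf c k; apply: (CkM (open_img c) (Ck_cst k _ (a : R))); exact: sf.
apply: smooth_vfD.
  exact: (smooth_vf_scale e (sc _ _ (smooth_fun_form e feta sZ)) sX).
exact: (smooth_vf_scale e (sc _ _ (smooth_fun_form e feta sX)) sZ).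
Qed.

End ContactFields.

(** * The induced endomorphism *)

Section Scalar.
Context {R : realType} {V : lmodType R}.
Variable F : V -> R.
Hypothesis lF : scalar F.

Lemma functional0 : F 0 = 0.
Proof. by have := lF (-1) 0 0; rewrite scaler0 addr0 mulN1r addNr. Qed.

Lemma functionalZ a u : F (a *: u) = a * F u.
Proof. by rewrite -[a *: u]addr0 lF functional0 addr0. Qed.

Lemma functionalD u v : F (u + v) = F u + F v.
Proof. by rewrite -[u in LHS]scale1r lF mul1r. Qed.

Lemma functionalN u : F (- u) = - F u.
Proof. by rewrite -scaleN1r functionalZ mulN1r. Qed.

Lemma functionalB u v : F (u - v) = F u - F v.
Proof. by rewrite functionalD functionalN. Qed.

End Scalar.

(* [d] stands for [dform eta]; it is abstract because [ring] would otherwise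
   compare its values by unfolding derivatives. *)
Section Endomorphism.
Context {R : realType} {E : normedModType R} (e : frame E) {M : smoothSpace E}.
Variables (eta mu : M -> E -> R) (d gM : M -> E -> E -> R).
Variable J : bundle M -> E * R -> E * R.

Definition omega_at (q : bundle M) (x y : E * R) : R :=
  x.2 * eta q.1 y.1 - y.2 * eta q.1 x.1 + fiber q * d q.1 x.1 y.1.

Hypotheses (eta_form : one_form eta) (mu_form : one_form mu).
Hypotheses (dL : forall p u, scalar (d p u)) (dC : forall p u v, d p u v = - d p v u).
Hypotheses (gM_metric : riemannian_metric gM) (J_tensor : tensor11 J).
Hypothesis metric_omega : forall q x y,
  bundle_metric mu gM q x y = omega_at q x (J q y).

Let etaL p : scalar (eta p) := eta_form.1 p.
Let muL p : scalar (mu p) := mu_form.1 p.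

Lemma metricC p u v : gM p u v = gM p v u.
Proof. by case: gM_metric. Qed.

Lemma metricL p u : scalar (gM p u).
Proof. by case: gM_metric. Qed.

Lemma metric_eq0 p u : gM p u u = 0 -> u = 0.
Proof.
move=> g0; apply/eqP; apply: contraT => u0.
by case: gM_metric => _ _ /(_ p u u0); rewrite g0 ltxx.
Qed.

Lemma JL q : linear (J q).
Proof. exact: J_tensor.1. Qed.

Lemma J0 q : J q 0 = 0.
Proof. by have := JL q (-1) 0 0; rewrite scaler0 addr0 scaleN1r addNr. Qed.

Lemma JZ q a x : J q (a *: x) = a *: J q x.
Proof. by have := JL q a x 0; rewrite J0 !addr0. Qed.

Lemma JD q x y : J q (x + y) = J q x + J q y.
Proof. by rewrite -[x in LHS]scale1r JL scale1r. Qed.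

Lemma JN q x : J q (- x) = - J q x.
Proof. by rewrite -scaleN1r JZ scaleN1r. Qed.

Lemma omega_at_antisym q x y : omega_at q x y = - omega_at q y x.
Proof. by rewrite /omega_at dC; ring. Qed.

Lemma omega_at_linear q x : scalar (omega_at q x).
Proof.
move=> a y z; rewrite /omega_at /=.
rewrite (etaL q.1 a y.1 z.1) (dL q.1 x.1 a y.1 z.1).
by rewrite -[a *: y.2]/(a * y.2); ring.
Qed.

Lemma bundle_metricC q x y : bundle_metric mu gM q x y = bundle_metric mu gM q y x.
Proof. by rewrite /bundle_metric metricC (mulrC (connection _ _ x)). Qed.

(** The horizontal lift of a single vector: its vertical component is the one on which ds/s + mu
    vanishes. *)
Definition hlift_at (q : bundle M) (u : E) : E * R := (u, - (mu q.1 u * fiber q)).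

Lemma hliftE X q : hlift mu X q = hlift_at q (X q.1).
Proof.
by apply: injective_projections => /=; rewrite ?scaler0 ?subr0 ?sub0r.
Qed.

Lemma fiber_neq0 (q : bundle M) : fiber q != 0.
Proof. by rewrite gt_eqF ?fiber_gt0. Qed.

Lemma connection_hl q u : connection mu q (hlift_at q u) = 0.
Proof.
by rewrite /connection /ds /pullback /= mulNr mulfK ?fiber_neq0 // addNr.
Qed.

Lemma connection_nabla q : connection mu q (nabla q) = 1.
Proof.
by rewrite /connection /ds /pullback /= divff ?fiber_neq0 // (functional0 (muL _)) addr0.
Qed.

Lemma connection_eq0 q x : connection mu q x = 0 -> x = hlift_at q x.1.
Proof.
rewrite /connection /ds /pullback => c0; apply: injective_projections => //=.
have /eqP := c0; rewrite addr_eq0 => /eqP c1.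
by rewrite -mulNr -c1 divfK // fiber_neq0.
Qed.

Lemma hlL q : linear (hlift_at q).
Proof.
move=> a u v; apply: injective_projections => //=.
by rewrite muL /GRing.scale /=; ring.
Qed.

Lemma splitE q x : x = hlift_at q x.1 + connection mu q x *: nabla q.
Proof.
apply: injective_projections => /=; first by rewrite scaler0 addr0.
rewrite /connection /ds /pullback -[X in _ + X]/(_ * fiber q).
by rewrite mulrDl divfK ?fiber_neq0 //; ring.
Qed.

Lemma metric_nabla q x : bundle_metric mu gM q (nabla q) x = fiber q * connection mu q x.
Proof.
by rewrite /bundle_metric connection_nabla metricC /= (functional0 (metricL _ _)) mul1r addr0.
Qed.

Lemma metric_hl q u x : bundle_metric mu gM q (hlift_at q u) x = fiber q * gM q.1 u x.1.
Proof. by rewrite /bundle_metric connection_hl mul0r add0r. Qed.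

Lemma omega_nabla q x : omega_at q (nabla q) x = fiber q * eta q.1 x.1.
Proof.
by rewrite /omega_at dC /= (functional0 (etaL _)) (functional0 (dL _ _)); ring.
Qed.

Lemma omega_hl q u v : omega_at q (hlift_at q u) (hlift_at q v) =
  fiber q * (mu q.1 v * eta q.1 u - mu q.1 u * eta q.1 v + d q.1 u v).
Proof. by rewrite /omega_at /=; ring. Qed.

(** Both summands of g(x, x) are nonnegative, so x is horizontal and its base component is zero. *)
Lemma bundle_metric_eq0 q x : bundle_metric mu gM q x x = 0 -> x = 0.
Proof.
move/eqP; rewrite /bundle_metric mulf_eq0 (negPf (fiber_neq0 q)) /= => /eqP g0.
have gx : 0 <= gM q.1 x.1 x.1.
  have [->|x0] := eqVneq x.1 0; first by rewrite (functional0 (metricL _ _)).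
  by case: gM_metric => _ _ /(_ q.1 x.1 x0) /ltW.
have cx : 0 <= connection mu q x * connection mu q x by rewrite -expr2 sqr_ge0.
have gx0 : gM q.1 x.1 x.1 = 0 by lra.
have cx0 : connection mu q x * connection mu q x = 0 by lra.
move/eqP: cx0; rewrite mulf_eq0 orbb => /eqP cx0.
rewrite (connection_eq0 cx0) (metric_eq0 gx0).
by apply: injective_projections => //=; rewrite (functional0 (muL _)) mul0r oppr0.
Qed.

(** Up to sign, g(z, z) is omega(J z, z), an instance of the hypothesis. *)
Lemma omega_nondegenerate q z : (forall x, omega_at q x z = 0) -> z = 0.
Proof.
move=> oz; apply: (@bundle_metric_eq0 q).
by rewrite metric_omega omega_at_antisym oz oppr0.
Qed.

(* Multiplication by s on the fibers rescales both omega and g by s, so it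
   commutes with J. *)
Lemma J_slice q x :
  let y := J (slice q.1) (x.1, x.2 / fiber q) in J q x = (y.1, fiber q * y.2).
Proof.
set y := J _ _ => /=; apply/eqP; rewrite -subr_eq0; apply/eqP.
apply: (@omega_nondegenerate q) => z.
rewrite (functionalB (omega_at_linear _ _)) -metric_omega.
have s0 := fiber_neq0 q.
have -> : omega_at q z (y.1, fiber q * y.2) =
    fiber q * omega_at (slice q.1) (z.1, z.2 / fiber q) y.
  by rewrite /omega_at fiber_slice /=; field.
rewrite -metric_omega /bundle_metric /connection /ds /pullback fiber_slice /=.
by rewrite !divr1 mul1r subrr.
Qed.

(** A and, below, phi_C are read off from J at s = 1, keeping base components only. [J_slice]
    transports them to every s; horizontality will come from J^2 = -id. *)
Definition A_field p : E := (J (slice p) (nabla (slice p))).1.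
Definition phi_of p u : E := (J (slice p) (hlift_at (slice p) u)).1.

Lemma J_nabla_fst q : (J q (nabla q)).1 = A_field q.1.
Proof.
rewrite J_slice /= /A_field; congr (J _ _).1.
by rewrite divff ?fiber_neq0 // /nabla fiber_slice.
Qed.

Lemma J_hl_fst q u : (J q (hlift_at q u)).1 = phi_of q.1 u.
Proof.
rewrite J_slice /= /phi_of; congr (J _ _).1.
by rewrite /hlift_at fiber_slice /= mulNr mulfK ?fiber_neq0 // mulr1.
Qed.

Lemma eta_J_nabla q : eta q.1 (J q (nabla q)).1 = 1.
Proof.
have := metric_omega q (nabla q) (nabla q).
rewrite metric_nabla connection_nabla omega_nabla.
by move=> /(mulfI (fiber_neq0 q)).
Qed.

Lemma eta_J_hl q u : eta q.1 (J q (hlift_at q u)).1 = 0.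
Proof.
have := metric_omega q (nabla q) (hlift_at q u).
rewrite metric_nabla connection_hl omega_nabla.
by move=> /(mulfI (fiber_neq0 q)).
Qed.

Lemma almost_complex_of_phi (phi : M -> E -> E) :
  (forall q, J q (J q (nabla q)) = - nabla q) ->
  (forall p v, eta p v = 0 -> eta p (phi p v) = 0) ->
  (forall p v, eta p v = 0 -> phi p (phi p v) = - v) ->
  (forall q u, eta q.1 u = 0 -> J q (hlift_at q u) = hlift_at q (phi q.1 u)) ->
  forall q x, J q (J q x) = - x.
Proof.
move=> J2n phiC phi2 Jphi q x.
have hlN u : hlift_at q (- u) = - hlift_at q u.
  by apply: injective_projections => //=; rewrite (functionalN (muL _)) mulNr.
have J2h u : eta q.1 u = 0 -> J q (J q (hlift_at q u)) = - hlift_at q u.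
  by move=> u0; rewrite Jphi // Jphi ?phiC // phi2 // hlN.
(* As eta is 1 on the base part of J(nabla), this y is a multiple of nabla plus the lift of a vector
   of C. On J(nabla), J^2 = -id follows by applying J to J^2(nabla) = -nabla. *)
pose y := x - eta q.1 x.1 *: J q (nabla q).
have y0 : eta q.1 y.1 = 0.
  by rewrite /y /= (functionalB (etaL _)) (functionalZ (etaL _)) eta_J_nabla mulr1 subrr.
have J2y : J q (J q y) = - y.
  rewrite [y in LHS](splitE q) [y in RHS](splitE q).
  by rewrite !JD !JZ J2n J2h // opprD scalerN.
have -> : x = y + eta q.1 x.1 *: J q (nabla q) by rewrite /y subrK.
by rewrite (JD q y) (JD q (J q y)) J2y !JZ J2n JN scalerN [RHS]opprD.
Qed.

(** * Consequences of J^2 = -id *)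

Section AlmostComplex.
Hypothesis J2 : forall q x, J q (J q x) = - x.

(** Compared with g(y, J x) = -omega(y, x), which follows by exchanging x and y, this is the
    skewness of J for g. *)
Lemma metric_J q x y : bundle_metric mu gM q x (J q y) = omega_at q y x.
Proof. by rewrite metric_omega J2 (functionalN (omega_at_linear _ _)) -omega_at_antisym. Qed.

Lemma connection_J q x : connection mu q (J q x) = - eta q.1 x.1.
Proof.
have := metric_J q (nabla q) x.
rewrite metric_nabla omega_at_antisym omega_nabla -mulrN.
by move=> /(mulfI (fiber_neq0 q)).
Qed.

Lemma J_nabla q : J q (nabla q) = hlift_at q (A_field q.1).
Proof.
rewrite -J_nabla_fst; apply: connection_eq0.
by rewrite connection_J /= (functional0 (etaL _)) oppr0.
Qed.

Lemma J_hl q u : eta q.1 u = 0 -> J q (hlift_at q u) = hlift_at q (phi_of q.1 u).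
Proof.
move=> u0; rewrite -J_hl_fst; apply: connection_eq0.
by rewrite connection_J /= u0 oppr0.
Qed.

Lemma phi_of_complex : complex_structure eta phi_of.
Proof.
split.
- by move=> p v _; exact: (eta_J_hl (slice p)).
- by move=> p a u v _ _; rewrite /phi_of hlL JL.
- move=> X [sX _].
  (* Smoothness is inherited from J applied to the smooth field X^h, restricted to s = 1. *)
  have -> : app_field phi_of X = (fun p => (app_field J (hlift mu X) (slice p)).1).
    by apply/funext => p; rewrite /app_field hliftE.
  by apply/smooth_slice/J_tensor.2; exact: (smooth_hlift e).
- move=> p v v0; have v0' : eta (slice p).1 v = 0 by [].
  have pv0 : eta (slice p).1 (phi_of p v) = 0 := eta_J_hl (slice p) v.
  have := J2 (slice p) (hlift_at (slice p) v).
  by rewrite (J_hl v0') (J_hl pv0) => /(congr1 fst).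
Qed.

Lemma smooth_A_field : smooth_vf A_field.
Proof. by apply: (smooth_slice (J_tensor.2 _ _)); exact: smooth_nabla. Qed.

Lemma eta_A_field p : eta p (A_field p) = 1.
Proof. exact: (eta_J_nabla (slice p)). Qed.

(** Compute g(u^h, J nabla) at s = 1: it is g_M(u, A) by horizontality of J(nabla), and omega(nabla,
    u^h) = eta(u) by [metric_J]. *)
Lemma metric_A_field p u : gM p (A_field p) u = eta p u.
Proof.
have := metric_J (slice p) (hlift_at (slice p) u) (nabla (slice p)).
rewrite omega_nabla metric_hl => /(mulfI (fiber_neq0 _)).
by rewrite J_nabla /= metricC.
Qed.

(** Orthogonality of u^h and nabla reads omega(u^h, A^h) = 0, where ds(u^h) contributes the term in
    mu(u). With the stated conventions the vector of C comes first: d eta(A, u) is -mu(u), opposite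
    to the sign in the English statement. *)
Lemma d_A_field p u : eta p u = 0 -> d p u (A_field p) = mu p u.
Proof.
move=> u0; have := metric_omega (slice p) (hlift_at (slice p) u) (nabla (slice p)).
rewrite J_nabla metric_hl omega_hl => /(mulfI (fiber_neq0 _)) /=.
by rewrite (functional0 (metricL _ _)) u0 eta_A_field; lra.
Qed.

Lemma A_field_unique_metric p b : (forall u, gM p b u = eta p u) -> b = A_field p.
Proof.
move=> bE; apply/eqP; rewrite -subr_eq0; apply/eqP/(@metric_eq0 p).
rewrite (functionalB (metricL _ _)) (metricC _ _ b) (metricC _ _ (A_field p)).
by rewrite bE metric_A_field subrr.
Qed.

Lemma J_plane q w : (exists a b, w = a *: nabla q + b *: hlift_at q (A_field q.1)) ->
  exists a b, J q w = a *: nabla q + b *: hlift_at q (A_field q.1).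
Proof.
(* J rotates the plane: nabla goes to A^h and A^h to -nabla. *)
move=> [a [b ->]]; exists (- b), a.
by rewrite JD !JZ -J_nabla J2 scalerN scaleNr addrC.
Qed.

(** The connection form reads off the coefficient of nabla, and eta that of A^h because eta(A) = 1;
    the remainder is then the lift of a vector of C. *)
Lemma plane_decomposition q x :
  x = (connection mu q x *: nabla q + eta q.1 x.1 *: hlift_at q (A_field q.1))
      + hlift_at q (x.1 - eta q.1 x.1 *: A_field q.1).
Proof.
rewrite {1}(splitE q x).
have -> : hlift_at q x.1 = eta q.1 x.1 *: hlift_at q (A_field q.1) +
    hlift_at q (x.1 - eta q.1 x.1 *: A_field q.1).
  by rewrite -hlL addrC subrK.
by rewrite addrC addrA.
Qed.

Lemma plane_metric_hl q a b u : eta q.1 u = 0 ->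
  bundle_metric mu gM q (a *: nabla q + b *: hlift_at q (A_field q.1)) (hlift_at q u) = 0.
Proof.
move=> u0; rewrite bundle_metricC metric_hl /= scaler0 add0r.
by rewrite (functionalZ (metricL _ _)) metricC metric_A_field u0 !mulr0.
Qed.

(** A common vector of the two orthogonal summands is orthogonal to itself. *)
Lemma plane_hl_eq0 q a b u : eta q.1 u = 0 ->
  a *: nabla q + b *: hlift_at q (A_field q.1) = hlift_at q u -> hlift_at q u = 0.
Proof.
move=> u0 wE; apply: (@bundle_metric_eq0 q).
by rewrite -{1}wE plane_metric_hl.
Qed.

Section LeviForm.
Variable phi : M -> E -> E.
Hypothesis J_phi : forall q u, eta q.1 u = 0 -> J q (hlift_at q u) = hlift_at q (phi q.1 u).

(** On lifts of vectors of C the terms of omega containing eta vanish and only s d eta remains,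
    while g reduces to s g_M. *)
Lemma metric_d p u v : eta p u = 0 -> eta p v = 0 ->
  gM p u v = d p u (phi p v).
Proof.
move=> u0 v0; have pv0 : eta p (phi p v) = 0.
  by have := eta_J_hl (slice p) v; rewrite J_phi.
have := metric_omega (slice p) (hlift_at (slice p) u) (hlift_at (slice p) v).
rewrite J_phi // metric_hl omega_hl => /(mulfI (fiber_neq0 _)) /= ->.
by rewrite u0 pv0; ring.
Qed.

End LeviForm.

(** This is nondegeneracy of d eta on C: z = b - A lies in C and d eta(., z) vanishes on C, so
    g_M(phi z, phi z) = -d eta(phi z, z) = 0. Then z = 0 because phi^2 = -id. *)
Lemma A_field_unique_d p b :
  (forall u, eta p u = 0 -> d p u b = mu p u) -> eta p b = 1 -> b = A_field p.
Proof.
move=> bd b1; apply/eqP; rewrite -subr_eq0; apply/eqP; set z := b - _.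
have z0 : eta p z = 0.
  by rewrite (functionalB (etaL _)) b1 eta_A_field subrr.
have [phiC _ _ phi2] := phi_of_complex.
have pz0 := phiC _ _ z0.
suff pz : phi_of p z = 0.
  have hl0 : hlift_at (slice p) 0 = 0.
    by have := hlL (slice p) (-1) 0 0; rewrite scaler0 addr0 scaleN1r addNr.
  by apply: oppr_inj; rewrite -(phi2 _ _ z0) pz /phi_of hl0 J0 oppr0.
apply: (@metric_eq0 p); rewrite (metric_d J_hl) // phi2 //.
by rewrite (functionalN (dL _ _)) (functionalB (dL _ _)) bd // d_A_field // subrr oppr0.
Qed.

End AlmostComplex.
End Endomorphism.

(** * Linear spans *)

Section LinSpan.
Context {R : realType} {V : lmodType R}.

Lemma lin_span_ind (S : set V) (P : V -> Prop) :
  P 0 -> (forall a u v, S u -> P v -> P (a *: u + v)) -> forall w, lin_span S w -> P w.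
Proof.
move=> P0 PS _ [k [a [u [Su ->]]]].
by elim/big_rec: _ => // i v _; apply: PS.
Qed.

Lemma lin_span1 (S : set V) u : S u -> lin_span S u.
Proof.
move=> Su; exists 1%N, (fun=> 1), (fun=> u); split=> //.
by rewrite big_ord1 scale1r.
Qed.

Lemma lin_span_pair (u v w : V) :
  lin_span [set u; v] w <-> exists a b, w = a *: u + b *: v.
Proof.
split.
  apply: (@lin_span_ind _ (fun w => exists a b, w = a *: u + b *: v)).
    by exists 0, 0; rewrite !scale0r addr0.
  move=> c x y [->|->] [a [b ->]].
    by exists (c + a), b; rewrite scalerDl addrA.
  by exists a, (c + b); rewrite scalerDl addrCA.
move=> [a [b ->]].
exists 2%N, (fun i => if i == ord0 then a else b), (fun i => if i == ord0 then u else v).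
split=> [i|]; first by case: ifP => _; [left|right].
by rewrite big_ord_recl big_ord1.
Qed.

End LinSpan.

(** * Passage from global fields to single tangent vectors *)

Section ContactBundle.
Context {R : realType} {n : nat} {M : smoothSpace 'rV[R]_(n * 2).+1}.
Local Notation E := 'rV[R]_(n * 2).+1.
Variables (eta mu : M -> E -> R) (gM : M -> E -> E -> R).
Variable J : bundle M -> E * R -> E * R.
Hypotheses (eta_contact : contact_form eta) (mu_form : one_form mu).

Let e := rV_frame (R := R) (n * 2).
Let feta : one_form eta := eta_contact.1.

Lemma bundle_extension (q : bundle M) x :
  exists2 X : vfield (bundle M), smooth_vf X & X q = x.
Proof.
have [X sX XE] := global_extension eta_contact q.1 x.1.
(* The constant coefficient compensates the factor s in nabla at the point q. *)
exists (fun q' => lift X q' + (x.2 / fiber q) *: nabla q').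
  apply: smooth_vfD; first exact: smooth_lift.
  exact: (smooth_nabla_scale e (smooth_fun_cst _)).
apply: injective_projections => /=; first by rewrite scaler0 addr0.
by rewrite add0r; apply: divfK; rewrite gt_eqF ?fiber_gt0.
Qed.

Lemma metric_omega_at : tensor11 J ->
  (forall X Y : vfield (bundle M), smooth_vf X -> smooth_vf Y ->
    forall q, bundle_metric mu gM q (X q) (Y q) = omega eta X (app_field J Y) q) ->
  forall q x y, bundle_metric mu gM q x y = omega_at eta (dform eta) q x (J q y).
Proof.
move=> [_ sJ] J_def q x y.
have [X sX XE] := bundle_extension q x; have [Y sY YE] := bundle_extension q y.
have := J_def X Y sX sY q; rewrite (omegaE e q feta sX (sJ _ sY)).
by rewrite /app_field XE YE.
Qed.

(** Lifting is linear at a point, so the lifts already form a subspace; conversely, each vector of C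
    at the point extends to a global section by [ker_extension]. *)
Lemma hker_hl (q : bundle M) x :
  hker eta mu q x <-> exists2 u, eta q.1 u = 0 & x = hlift_at mu q u.
Proof.
split.
  apply: (@lin_span_ind _ _ _ (fun x => exists2 u, eta q.1 u = 0 & x = hlift_at mu q u)).
    exists 0; first exact: functional0 (feta.1 _).
    apply: injective_projections => //=.
    by rewrite (functional0 (mu_form.1 _)) mul0r oppr0.
  move=> a _ _ [X [sX X0] ->] [u u0 ->]; rewrite hliftE.
  exists (a *: X q.1 + u); last by rewrite hlL.
  by rewrite (functionalD (feta.1 _)) (functionalZ (feta.1 _)) X0 u0 mulr0 addr0.
move=> [u u0 ->]; have [X kX XE] := ker_extension eta_contact u0.
by apply: lin_span1; exists X; rewrite ?hliftE ?XE.
Qed.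

End ContactBundle.

(** * Assembly of the pointwise results *)

Theorem theorem9p2 (R : realType) (n : nat)
  (M : smoothSpace 'rV[R]_(n * 2).+1)
  (hausdorffM : hausdorff_space M) (countableM : @second_countable M)
  (eta mu : M -> 'rV[R]_(n * 2).+1 -> R)
  (gM : M -> 'rV[R]_(n * 2).+1 -> 'rV[R]_(n * 2).+1 -> R)
  (eta_contact : contact_form eta) (mu_form : one_form mu)
  (gM_metric : riemannian_metric gM)
  (J : bundle M -> 'rV[R]_(n * 2).+1 * R -> 'rV[R]_(n * 2).+1 * R)
  (J_tensor : tensor11 J)
  (J_def : forall X Y : vfield (bundle M), smooth_vf X -> smooth_vf Y ->
     forall q, bundle_metric mu gM q (X q) (Y q) = omega eta X (app_field J Y) q) :
  let almost_complex := forall q v, J q (J q v) = - v in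
  let intertwines phi := forall X : vfield M, in_ker eta X ->
    forall q, J q (hlift mu X q) = hlift mu (app_field phi X) q in
  (almost_complex <->
     (forall q, J q (J q (nabla q)) = - nabla q) /\
     (exists phi, complex_structure eta phi /\ intertwines phi)) /\
  (almost_complex ->
   forall phi, complex_structure eta phi -> intertwines phi ->
   [/\ levi_structure eta phi,
       forall X Y, in_ker eta X -> in_ker eta Y -> forall p,
         gM p (X p) (Y p) = ext_deriv eta X (app_field phi Y) p,
       exists A : vfield M,
         [/\ smooth_vf A,
             forall q, J q (nabla q) = hlift mu A q,
             forall B : vfield M, smooth_vf B ->
               ((forall X, in_ker eta X -> forall p,
                   ext_deriv eta X B p = mu p (X p)) /\
                (forall p, eta p (B p) = 1)
                <-> forall p, B p = A p),
             forall B : vfield M, smooth_vf B ->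
               ((forall X, smooth_vf X -> forall p,
                   gM p (B p) (X p) = eta p (X p)) /\
                (forall p, eta p (B p) = 1)
                <-> forall p, B p = A p)
           & forall q,
               let W := lin_span [set nabla q; hlift mu A q] in
               let Ch := hker eta mu q in
               [/\ direct_sum W Ch,
                   forall w, W w -> W (J q w),
                   forall w, Ch w -> Ch (J q w)
                 & forall w c, W w -> Ch c -> bundle_metric mu gM q w c = 0]]
     & forall X Y, in_ker eta X -> in_ker eta Y -> forall p,
         ext_deriv eta (app_field phi X) (app_field phi Y) p
         = ext_deriv eta X Y p]).
Proof.
move=> AC intertwines.
set e := rV_frame (R := R) (n * 2).
have feta : one_form eta := eta_contact.1.
have etaL := feta.1.
have dL p u : scalar (dform eta p u) by exact: dform_linear.
have dC p u v : dform eta p u v = - dform eta p v u by exact: dform_antisym.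
have mo := metric_omega_at eta_contact J_tensor J_def.
have intE phi : intertwines phi <->
    forall q u, eta q.1 u = 0 -> J q (hlift_at mu q u) = hlift_at mu q (phi q.1 u).
  split=> [h q u u0|h X [_ X0] q]; last by rewrite !hliftE; apply: h.
  have [X kX XE] := ker_extension eta_contact u0.
  by have := h X kX q; rewrite !hliftE /app_field XE.
have dE X Y p : smooth_vf X -> smooth_vf Y ->
    ext_deriv eta X Y p = dform eta p (X p) (Y p).
  by move=> sX sY; exact: (ext_derivE e p feta sX sY).
split.
  split=> [J2|[J2n [phi [[phiC _ _ phi2] /intE Jphi]]]]; last first.
    exact: (almost_complex_of_phi feta mu_form dL dC gM_metric J_tensor mo J2n phiC phi2 Jphi).
  split; first by move=> q; exact: J2.
  exists (phi_of mu J); split.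
    exact: (phi_of_complex e feta mu_form dL dC gM_metric J_tensor mo J2).
  apply/intE => q u.
  exact: (J_hl feta mu_form dL dC gM_metric mo J2).
(* From here phi is an arbitrary complex structure intertwined with J, whereas A is built from J
   alone. *)
move=> J2 phi cphi /intE Jphi; have [phiC _ sphi phi2] := cphi.
have gd p u v : eta p u = 0 -> eta p v = 0 -> gM p u v = dform eta p u (phi p v).
  exact: (metric_d feta mu_form dL dC gM_metric mo Jphi).
have gdX X Y : in_ker eta X -> in_ker eta Y -> forall p,
    gM p (X p) (Y p) = ext_deriv eta X (app_field phi Y) p.
  by move=> kX kY p; rewrite (dE X _ p kX.1 (sphi Y kY)) gd ?kX.2 ?kY.2.
pose A := A_field J.
have JA q : J q (nabla q) = hlift_at mu q (A q.1).
  exact: (J_nabla feta mu_form dL dC gM_metric mo J2).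
have sA : smooth_vf A by exact: smooth_A_field.
have A1 p : eta p (A p) = 1 by exact: (eta_A_field feta mu_form dL dC gM_metric mo).
have Ad p u : eta p u = 0 -> dform eta p u (A p) = mu p u.
  exact: (d_A_field feta mu_form dL dC gM_metric mo J2).
have Ag p u : gM p (A p) u = eta p u.
  exact: (metric_A_field feta mu_form dL dC gM_metric mo J2).
split; last first.
- move=> X Y kX kY p.
  rewrite (dE _ _ p (sphi X kX) (sphi Y kY)) (dE _ _ p kX.1 kY.1) /app_field.
  have X0 := kX.2 p; have Y0 := kY.2 p.
  (* The chain is d eta(phi X, phi Y) = g_M(phi X, Y) = g_M(Y, phi X) = d eta(Y, phi^2 X) = d eta(X,
     Y). *)
  rewrite -(gd p _ _ (phiC p _ X0) Y0) (metricC gM_metric).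
  rewrite (gd p _ _ Y0 (phiC p _ X0)) (phi2 p _ X0).
  by rewrite (functionalN (dL _ _)) -dC.
- exists A; split.
  + exact: sA.
  + by move=> q; rewrite hliftE; exact: JA.
  + move=> B sB; split=> [[Bd B1] p|BA].
      apply: (A_field_unique_d e feta mu_form dL dC gM_metric J_tensor mo J2) => // u u0.
      have [X kX XE] := ker_extension eta_contact u0.
      by rewrite -[in LHS]XE -(dE X B p kX.1 sB) (Bd X kX) XE.
    split=> [X kX p|p]; last by rewrite BA.
    by rewrite (dE X B p kX.1 sB) BA Ad // kX.2.
  + move=> B sB; split=> [[Bg B1] p|BA].
      apply: (A_field_unique_metric feta mu_form dL dC gM_metric mo J2) => u.
      by have [X sX <-] := global_extension eta_contact p u; exact: Bg.
    by split=> [X sX p|p]; rewrite BA ?Ag.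
  + move=> q; rewrite hliftE => W Ch.
    have WE w : W w <-> exists a b, w = a *: nabla q + b *: hlift_at mu q (A q.1).
      exact: lin_span_pair.
    have CE c : Ch c <-> exists2 u, eta q.1 u = 0 & c = hlift_at mu q u.
      exact: (hker_hl eta_contact mu_form).
    split.
    * split=> [x|x /WE [a [b ->]] /CE [u u0 xE]].
        exists (connection mu q x *: nabla q + eta q.1 x.1 *: hlift_at mu q (A q.1)).
        exists (hlift_at mu q (x.1 - eta q.1 x.1 *: A q.1)); split.
        - by apply/WE; exists (connection mu q x), (eta q.1 x.1).
        - apply/CE; exists (x.1 - eta q.1 x.1 *: A q.1) => //.
          by rewrite (functionalB (etaL _)) (functionalZ (etaL _)) A1 mulr1 subrr.
        - exact: plane_decomposition.
      rewrite xE.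
      exact: (plane_hl_eq0 feta mu_form dL dC gM_metric mo J2 u0 xE).
    * move=> w /WE wE; apply/WE.
      exact: (J_plane feta mu_form dL dC gM_metric J_tensor mo J2 wE).
    * move=> w /CE [u u0 ->]; apply/CE; exists (phi q.1 u); first exact: phiC.
      exact: Jphi.
    * move=> w c /WE [a [b ->]] /CE [u u0 ->].
      exact: (plane_metric_hl feta mu_form dL dC gM_metric mo J2).
- exact: gdX.
(* Symmetry and positivity of the Levi form are those of g_M, with which it agrees on C. *)
- split; first exact: cphi.
    move=> X Y kX kY p; rewrite -(gdX X Y kX kY) -(gdX Y X kY kX).
    exact: (metricC gM_metric).
  move=> X kX p Xp0; rewrite -(gdX X X kX kX).
  by case: gM_metric => _ _ + _; apply.
Qed.
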